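(* For every fixed $\eta>0$ and every integer $n$ that is sufficiently large with respect to $\eta$, there exists an $n$-vertex graph $G$ with $\alpha(G)\leq 2$ which does not have $K_t$ as an odd minor for any integer $t\geq (\frac13+\eta)n$.
   Context: All graphs are finite and simple; $\alpha(G)$ denotes the independence number. A graph $G$ has $K_t$ as an odd minor if there exist vertex-disjoint trees $T_1,\dots,T_t\subseteq G$ and functions $\chi_i:V(T_i)\to\{\text{black},\text{white}\}$ such that (i) for every $i$, $\chi_i$ is a proper $2$-coloring of $T_i$, and (ii) for all $i\neq j$ there are vertices $x_i\in V(T_i)$, $x_j\in V(T_j)$ with $\{x_i,x_j\}\in E(G)$ and $\chi_i(x_i)=\chi_j(x_j)$. *)

(* Defs.v *)
From HB Require Import structures.
From mathcomp Require Import all_boot all_order all_algebra.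
From mathcomp Require Export reals.
Set Implicit Arguments. Unset Strict Implicit. Unset Printing Implicit Defensive.

Definition simple_graph (T : finType) (e : rel T) : Prop :=
  symmetric e /\ irreflexive e.

Definition independent_set (T : finType) (e : rel T) (A : {set T}) : bool :=
  [forall x in A, forall y in A, (x != y) ==> ~~ e x y].

Definition alpha (T : finType) (e : rel T) : nat :=
  \max_(A : {set T} | independent_set e A) #|A|.

(* (S, F) is a tree subgraph of the graph e: nonempty vertex set S, edge
   relation F (symmetric) made of edges of e inside S, connected on S, with
   exactly #|S| - 1 edges (each edge counted twice as an ordered pair). *)
Definition is_tree_subgraph (T : finType) (e : rel T) (S : {set T}) (F : rel T) : Prop :=
  [/\ S != set0,
      (forall x y, F x y -> [/\ e x y, x \in S & y \in S]),
      symmetric F,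
      (forall x y, x \in S -> y \in S -> connect F x y)
    & #|[set p : T * T | F p.1 p.2]| = (#|S| - 1).*2].

Definition has_odd_minor (T : finType) (e : rel T) (t : nat) : Prop :=
  exists (S : 'I_t -> {set T}) (F : 'I_t -> rel T) (c : 'I_t -> T -> bool),
    [/\ (forall i, is_tree_subgraph e (S i) (F i)),
        (forall i j, i != j -> [disjoint S i & S j]),
        (forall i x y, F i x y -> c i x != c i y)
      & (forall i j, i != j ->
           exists x y, [/\ x \in S i, y \in S j, e x y & c i x == c j y])].

(* Main.v *)
Require Import Defs.
From HB Require Import structures.
From mathcomp Require Import all_boot all_order all_algebra all_field.
From mathcomp Require Import reals.
From mathcomp Require Import zify ring lra.
Set Implicit Arguments. Unset Strict Implicit. Unset Printing Implicit Defensive.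
Import Order.TTheory GRing.Theory Num.Theory.

(* Take for [G] the complement of a triangle-free graph [H].  As the trees of an
   odd [K_t] minor are disjoint, linearly many of them have one or two vertices
   when [t >= (1/3 + eta) n].  Many one-vertex trees give a large stable set of
   [H]; many two-vertex trees, with black vertices [b_i] and white vertices
   [w_i], give disjoint pairs such that [b_i b_j] and [w_i w_j] are never both
   edges of [H].  It thus suffices that for linearly many disjoint pairs some
   [i <> j] has both [b_i b_j] and [w_i w_j] in [H].

   [H] is a random sample of [n] points of the affine polar graph on [F_q^4],
   where [x ~ y] if [x - y] is isotropic for an elliptic quadratic form.  The
   triangles of this graph are collinear, and they are destroyed by splitting
   each line at random into two parts.  The density is [1/q], so pairs have
   common edges in abundance as soon as [n] exceeds [q^2] by a power of [q].
   The positive non-principal eigenvalue is only [q], while the negative one is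
   of order [q^2]; hence a balanced set without edges in the tensor square of
   the graph has size [O(q^5)], i.e. density [O(q^-3)].  By Kleitman--Winston
   containers a given matching with [m] pairs is bad with probability about
   [q^(-3m)], which beats the number [n^m] of matchings if [n] is smaller than
   [q^3] by a power of [q]. *)

(** * Containers in the tensor square *)

Section Kernel.
Local Open Scope ring_scope.
Variables (T : finType) (P : T -> T -> int) (c : int).
Hypotheses (c_gt0 : 0 < c) (Psym : forall x y, P x y = P y x).
Hypothesis (Pidem : forall x y, \sum_z P x z * P z y = c * P x y).

Definition form (v : T -> int) := \sum_x \sum_y v x * v y * P x y.

(** [P] is symmetric and [P^2 = c P], so [P / c] is an orthogonal projection and the squared norm of
    [P v] is a multiple of the form. *)
Lemma form_image v : \sum_z (\sum_x v x * P x z) ^+ 2 = c * form v.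
Proof.
rewrite /form big_distrr /=.
under [RHS]eq_bigr => x _.
  rewrite big_distrr /=.
  under eq_bigr => y _ do rewrite mulrCA -Pidem big_distrr /=.
  rewrite exchange_big /=; over.
rewrite exchange_big /=; apply: eq_bigr => z _.
rewrite expr2 big_distrl /=; apply: eq_bigr => x _.
rewrite big_distrr /=; apply: eq_bigr => y _.
by rewrite (Psym z y); ring.
Qed.

Lemma form_ge0 v : 0 <= form v.
Proof.
by rewrite -(pmulr_rge0 _ c_gt0) -form_image sumr_ge0 // => z _; apply: sqr_ge0.
Qed.

(** After multiplication by [c], the difference of the two sides is the squared norm of
    [c v - P v]. *)
Lemma form_le v : form v <= c * \sum_x v x ^+ 2.
Proof.
rewrite -subr_ge0 -(pmulr_rge0 _ c_gt0).
have -> : c * (c * (\sum_x v x ^+ 2) - form v) =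
    \sum_z (c * v z - \sum_x v x * P x z) ^+ 2.
  under [RHS]eq_bigr => z _.
    have -> : (c * v z - \sum_x v x * P x z) ^+ 2 =
      c ^+ 2 * v z ^+ 2 - 2%:R * c * (\sum_x v x * v z * P x z) + (\sum_x v x * P x z) ^+ 2.
      rewrite [in RHS](_ : \sum_x v x * v z * P x z = v z * \sum_x v x * P x z); first by ring.
      by rewrite big_distrr /=; apply: eq_bigr => x _; ring.
    over.
  rewrite big_split /= form_image sumrB -!big_distrr /= exchange_big /= -/(form v).
  by ring.
by rewrite sumr_ge0 // => z _; apply: sqr_ge0.
Qed.

End Kernel.
(* [ring] only recognises the type [int] when it appears syntactically. *)
Ltac int_ring := match goal with |- @eq _ ?a ?b => change (@eq int a b); ring end.

(** * Edge counts and containers for a graph with the parameters of the affine polar graph *)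

Section Containers.
Local Open Scope ring_scope.
Variables (X : finType) (q : nat) (G : rel X).
Hypotheses (q_gt1 : (1 < q)%N) (Gsym : symmetric G) (Grefl : reflexive G).
Hypothesis cardX : #|X| = (q ^ 4)%N.
Hypothesis codegG : forall x y, #|[set z | G x z && G z y]| =
  (if x == y then q ^ 3 - q ^ 2 + q else if G x y then q else q ^ 2 - q)%N.

Let g x y : int := (G x y)%:R.
Let dl (x y : X) : int := (x == y)%:R.
Let Q : int := q%:R.
Let QE : Q = q%:R := erefl.

(* [G] has the eigenvalues [q^3 - q^2 + q], [q] and [q - q^2]; this kernel
   vanishes on the eigenspace of [q] and is [q^3] on the other two. *)
Definition kernel x y : int := 1 + Q ^+ 2 * dl x y - Q * g x y.

Lemma sum_codeg x y : \sum_z g x z * g z y =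
  if x == y then Q ^+ 3 - Q ^+ 2 + Q else if G x y then Q else Q ^+ 2 - Q.
Proof.
transitivity ((#|[set z | G x z && G z y]|)%:R : int).
  rewrite -sum1_card natr_sum [RHS]big_mkcond /=; apply: eq_bigr => z _.
  by rewrite inE /g; case: (G x z); case: (G z y); rewrite ?mulr1 ?mulr0.
rewrite codegG QE; case: ifP => _; last case: ifP => _ //.
  by rewrite natrD natrB ?natrX // leq_exp2l.
by rewrite natrB ?natrX // -{1}(expn1 q) leq_exp2l.
Qed.

Lemma sum_deg x : \sum_z g x z = Q ^+ 3 - Q ^+ 2 + Q.
Proof.
have := sum_codeg x x; rewrite eqxx => <-; apply: eq_bigr => z _.
by rewrite /g (Gsym z x); case: (G x z); rewrite ?mulr1 ?mulr0.
Qed.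

Lemma sum_delta (v : X -> int) x : \sum_z dl x z * v z = v x.
Proof.
rewrite (bigD1 x) //= /dl eqxx mul1r big1 ?addr0 // => z /negbTE.
by rewrite eq_sym => ->; rewrite mul0r.
Qed.

(** With [J] the all-ones matrix, the square of [J + Q^2 I - Q g] depends only on the order, the
    degree and the codegrees of the graph. The identity is then checked for equal, adjacent and
    non-adjacent [x], [y]. *)
Lemma kernel_idem x y : \sum_z kernel x z * kernel z y = Q ^+ 3 * kernel x y.
Proof.
(* The deltas carry a factor [1] so that [sum_delta] evaluates their sums. *)
transitivity (\sum_z (1 + Q ^+ 2 * (dl x z * 1) + Q ^+ 2 * (dl y z * 1)
  - Q * g x z - Q * g y z + Q ^+ 4 * (dl x z * dl z y) - Q ^+ 3 * (dl x z * g z y)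
  - Q ^+ 3 * (dl y z * g x z) + Q ^+ 2 * (g x z * g z y))).
  apply: eq_bigr => z _; rewrite /kernel.
  have -> : dl z y = dl y z by rewrite /dl eq_sym.
  have -> : g y z = g z y by rewrite /g Gsym.
  int_ring.
rewrite !big_split /= !sumrN -!big_distrr /= !sum_delta sum_codeg !sum_deg.
have -> : \sum_(z : X) (1 : int) = Q ^+ 4.
  by rewrite sumr_const cardT -cardE cardX QE natrX.
rewrite /kernel /dl /g; have [->|xy] := eqVneq x y; first by rewrite Grefl /=; int_ring.
by case: (G x y) => /=; int_ring.
Qed.

Lemma kernel_sym x y : kernel x y = kernel y x.
Proof. by rewrite /kernel /g /dl (Gsym x) eq_sym. Qed.

Let Q_gt0 : 0 < Q. Proof. by rewrite QE ltr0n; lia. Qed.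

Lemma sum_delta2 (v : X -> X -> int) : \sum_y \sum_y' v y y' * dl y y' = \sum_y v y y.
Proof.
by apply: eq_bigr => y _; under eq_bigr do rewrite mulrC; rewrite sum_delta.
Qed.

Section Edges.
Variable K : {set X * X}.
Let a x y : int := ((x, y) \in K)%:R.

Let a_ge0 x y : 0 <= a x y. Proof. exact: ler0n. Qed.
(** [K] is a vertex set of the tensor square; the sum runs over ordered pairs of elements of [K]. *)
Let sum4 (h : X -> X -> X -> X -> int) :=
  \sum_x \sum_y \sum_x' \sum_y' a x y * a x' y' * h x y x' y'.

(** The number of ordered pairs of elements of [K] with a common first coordinate. It is small
    compared with [#|K|^2] when no row is heavy. *)
Definition row_sq : int := \sum_x (\sum_y a x y) ^+ 2.
Definition col_sq : int := \sum_y (\sum_x a x y) ^+ 2.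

Let sum4_1 : sum4 (fun _ _ _ _ => 1) = (#|K|)%:R ^+ 2.
Proof.
have -> : (#|K|)%:R = \sum_x \sum_y a x y.
  rewrite pair_big /= -sum1_card natr_sum big_mkcond /=.
  by apply: eq_bigr => -[x y] _; rewrite /a; case: (_ \in _).
rewrite expr2 big_distrl /=; apply: eq_bigr => x _.
rewrite big_distrl /=; apply: eq_bigr => y _.
rewrite big_distrr /=; apply: eq_bigr => x' _.
by rewrite big_distrr /=; apply: eq_bigr => y' _; rewrite mulr1.
Qed.

Let sum4_row (h : X -> X -> int) : sum4 (fun x _ x' _ => h x x') =
  \sum_x \sum_x' (\sum_y a x y) * (\sum_y a x' y) * h x x'.
Proof.
apply: eq_bigr => x _; rewrite exchange_big /=; apply: eq_bigr => x' _.
rewrite -mulrA big_distrl /=; apply: eq_bigr => y _.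
rewrite mulrC !big_distrl /=; apply: eq_bigr => y' _; int_ring.
Qed.

Let sum4_col (h : X -> X -> int) : sum4 (fun _ y _ y' => h y y') =
  \sum_y \sum_y' (\sum_x a x y) * (\sum_x a x y') * h y y'.
Proof.
rewrite /sum4 exchange_big /=; apply: eq_bigr => y _.
under eq_bigr do rewrite exchange_big /=.
rewrite exchange_big /=; apply: eq_bigr => y' _.
rewrite -mulrA big_distrl /=; apply: eq_bigr => x _.
rewrite mulrC !big_distrl /=; apply: eq_bigr => x' _; int_ring.
Qed.

Let sum4_same_col (h : X -> X -> int) :
  sum4 (fun x y x' y' => h x x' * dl y y') = \sum_y \sum_x \sum_x' a x y * a x' y * h x x'.
Proof.
rewrite /sum4 exchange_big /=; apply: eq_bigr => y _.
apply: eq_bigr => x _; apply: eq_bigr => x' _.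
transitivity (\sum_y' dl y y' * (a x y * a x' y' * h x x')); last by rewrite sum_delta.
by apply: eq_bigr => y' _; int_ring.
Qed.

Let sum4_same_row (h : X -> X -> int) :
  sum4 (fun x y x' y' => h y y' * dl x x') = \sum_x \sum_y \sum_y' a x y * a x y' * h y y'.
Proof.
apply: eq_bigr => x _; apply: eq_bigr => y _.
transitivity (\sum_x' dl x x' * (\sum_y' a x y * a x' y' * h y y')); last by rewrite sum_delta.
by apply: eq_bigr => x' _; rewrite big_distrr /=; apply: eq_bigr => y' _; int_ring.
Qed.

Let sum4D h1 h2 : sum4 (fun x y x' y' => h1 x y x' y' + h2 x y x' y') = sum4 h1 + sum4 h2.
Proof.
rewrite /sum4 -big_split /=; apply: eq_bigr => x _; rewrite -big_split /=; apply: eq_bigr => y _.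
rewrite -big_split /=; apply: eq_bigr => x' _; rewrite -big_split /=; apply: eq_bigr => y' _.
by rewrite mulrDr.
Qed.

Let sum4Z c h : sum4 (fun x y x' y' => c * h x y x' y') = c * sum4 h.
Proof.
rewrite /sum4 big_distrr /=; apply: eq_bigr => x _; rewrite big_distrr /=; apply: eq_bigr => y _.
rewrite big_distrr /=; apply: eq_bigr => x' _; rewrite big_distrr /=; apply: eq_bigr => y' _.
by int_ring.
Qed.

Let sum4_ge0 h : (forall x y x' y', 0 <= h x y x' y') -> 0 <= sum4 h.
Proof. by move=> hh; do 4 (apply: sumr_ge0 => ? _); rewrite !mulr_ge0. Qed.

Let sum4_eq h1 h2 : (forall x y x' y', h1 x y x' y' = h2 x y x' y') -> sum4 h1 = sum4 h2.
Proof. by move=> hh; do 4 (apply: eq_bigr => ? _); rewrite hh. Qed.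

Let sqK x y : a x y ^+ 2 = a x y.
Proof. by rewrite /a; case: (_ \in _); rewrite ?expr1n ?expr0n. Qed.

Let cardK_row : \sum_x \sum_y a x y = (#|K|)%:R.
Proof.
rewrite pair_big /= -sum1_card natr_sum [RHS]big_mkcond /=.
by apply: eq_bigr => -[x y] _; rewrite /a; case: (_ \in _).
Qed.

(** Substitute [Q g = 1 + Q^2 dl - kernel] in both factors and expand. The terms with deltas only
    and the product of two kernels contribute nonnegatively. The two single kernels cost
    [Q^3 row_sq] and [Q^3 col_sq], and each of the two mixed terms costs [Q^5 #|K|]. *)
Lemma edges_lower_bound :
  Q ^+ 2 * sum4 (fun x y x' y' => g x x' * g y y') >=
  (#|K|)%:R ^+ 2 - Q ^+ 3 * (row_sq + col_sq) - 2%:R * Q ^+ 5 * (#|K|)%:R.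
Proof.
have Q3 : 0 < Q ^+ 3 by rewrite exprn_gt0.
(* The tensor square of the kernel satisfies the same quadratic relation with constant [Q^6], hence
   is positive semidefinite. *)
have PP : 0 <= sum4 (fun x y x' y' => kernel x x' * kernel y y').
  have := @form_ge0 (X * X)%type (fun p p' => kernel p.1 p'.1 * kernel p.2 p'.2) (Q ^+ 6).
  move=> h; have {h} := h _ _ _ (fun p => a p.1 p.2).
  rewrite exprn_gt0 //; move=> /(_ isT).
  move=> h; have {h} := h _ _; rewrite /form.
  rewrite (_ : \sum_x _ = sum4 (fun x y x' y' => kernel x x' * kernel y y')).
    apply; first by move=> x y; rewrite kernel_sym (kernel_sym x.2).
    move=> x y; transitivity ((\sum_z kernel x.1 z * kernel z y.1) * (\sum_z kernel x.2 z * kernel z y.2)).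
      rewrite big_distrl /=; under [RHS]eq_bigr do rewrite big_distrr /=.
      by rewrite pair_big /=; apply: eq_bigr => z _; int_ring.
    by rewrite !kernel_idem; int_ring.
  rewrite /sum4 [RHS]pair_big /=; apply: eq_bigr => -[x y] _ /=.
  by rewrite [RHS]pair_big /=; apply: eq_bigr => -[x' y'] _ /=.
have R1 : sum4 (fun x _ x' _ => kernel x x') <= Q ^+ 3 * row_sq.
  by rewrite sum4_row; apply: (form_le Q3 kernel_sym kernel_idem).
have R2 : sum4 (fun _ y _ y' => kernel y y') <= Q ^+ 3 * col_sq.
  by rewrite sum4_col; apply: (form_le Q3 kernel_sym kernel_idem).
(* For each [y], [form_le] is applied to the column of [K] at [y], a 0-1 vector and so equal to its
   entrywise square. *)
have R3 : sum4 (fun x y x' y' => kernel x x' * dl y y') <= Q ^+ 3 * (#|K|)%:R.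
  rewrite sum4_same_col -cardK_row [X in _ <= _ * X]exchange_big big_distrr /=; apply: ler_sum => y _.
  apply: le_trans (form_le Q3 kernel_sym kernel_idem _) _.
  by apply: ler_wpM2l; [exact: ltW | apply: ler_sum => x _; rewrite sqK].
have R4 : sum4 (fun x y x' y' => kernel y y' * dl x x') <= Q ^+ 3 * (#|K|)%:R.
  rewrite sum4_same_row -cardK_row big_distrr /=; apply: ler_sum => x _.
  apply: le_trans (form_le Q3 kernel_sym kernel_idem _) _.
  by apply: ler_wpM2l; [exact: ltW | apply: ler_sum => y _; rewrite sqK].
have S1 : 0 <= sum4 (fun x y x' y' => dl x x' + dl y y' + Q ^+ 2 * (dl x x' * dl y y')).
  have dl0 u v : 0 <= dl u v by apply: ler0n.
  by apply: sum4_ge0 => *; apply: addr_ge0; [exact: addr_ge0 | rewrite !mulr_ge0 // ltW].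
have -> : Q ^+ 2 * sum4 (fun x y x' y' => g x x' * g y y') =
  sum4 (fun _ _ _ _ => 1)
  + Q ^+ 2 * sum4 (fun x y x' y' => dl x x' + dl y y' + Q ^+ 2 * (dl x x' * dl y y'))
  + (-1) * sum4 (fun x _ x' _ => kernel x x')
  + (-1) * sum4 (fun _ y _ y' => kernel y y')
  + (- Q ^+ 2) * sum4 (fun x y x' y' => kernel x x' * dl y y')
  + (- Q ^+ 2) * sum4 (fun x y x' y' => kernel y y' * dl x x')
  + sum4 (fun x y x' y' => kernel x x' * kernel y y').
  rewrite -!sum4Z -!sum4D; apply: sum4_eq => x y x' y'; rewrite /kernel; int_ring.
rewrite sum4_1.
have Q2 : 0 <= Q ^+ 2 by rewrite exprn_ge0 ?ltW.
have h1 := mulr_ge0 Q2 S1.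
have h3 := ler_wpM2l Q2 R3; have h4 := ler_wpM2l Q2 R4.
have e5 : Q ^+ 2 * (Q ^+ 3 * (#|K|)%:R) = Q ^+ 5 * (#|K|)%:R by int_ring.
move: h3 h4; rewrite e5; lra.
Qed.


Let sum_pairs (h : X * X -> int) : \sum_p h p = \sum_x \sum_y h (x, y).
Proof. by rewrite pair_big /=; apply: eq_bigr => -[]. Qed.

Lemma sum_row x : \sum_y a x y = (#|[set p in K | p.1 == x]|)%:R.
Proof.
rewrite -sum1_card natr_sum [RHS]big_mkcond /=.
rewrite sum_pairs /=.
rewrite [RHS](bigD1 x) //= [X in _ + X]big1 ?addr0 => [|x' /negbTE xx'].
  by apply: eq_bigr => y _; rewrite inE eqxx andbT /a; case: (_ \in _).
by apply: big1 => y _; rewrite inE /= xx' andbF.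
Qed.

Lemma sum_col y : \sum_x a x y = (#|[set p in K | p.2 == y]|)%:R.
Proof.
rewrite -sum1_card natr_sum [RHS]big_mkcond /=.
rewrite sum_pairs /=.
apply: eq_bigr => x _; rewrite (bigD1 y) //= [X in _ + X]big1 ?addr0 => [|y' /negbTE yy'].
  by rewrite inE eqxx andbT /a; case: (_ \in _).
by rewrite inE /= yy' andbF.
Qed.

(** [G] has loops; the two inequalities remove them, so this is the neighbourhood of [v] in the
    tensor square of the loopless graph. *)
Definition nb (v : X * X) : {set X * X} :=
  [set w | [&& w.1 != v.1, w.2 != v.2, G v.1 w.1 & G v.2 w.2]].

(** An adjacent pair of the tensor square with loops that is lost in [nb] has equal first or equal
    second coordinates. *)
Lemma sum_nb_lower_bound :
  sum4 (fun x y x' y' => g x x' * g y y') - row_sq - col_sq <=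
  \sum_(v in K) (#|K :&: nb v|)%:R.
Proof.
have R : row_sq = sum4 (fun x y x' y' => dl x x').
  by rewrite sum4_row sum_delta2; apply: eq_bigr => x _; rewrite expr2.
have C : col_sq = sum4 (fun x y x' y' => dl y y').
  by rewrite sum4_col sum_delta2; apply: eq_bigr => x _; rewrite expr2.
have N : \sum_(v in K) (#|K :&: nb v|)%:R =
  sum4 (fun x y x' y' => ((x', y') \in nb (x, y))%:R).
  rewrite big_mkcond /= sum_pairs.
  apply: eq_bigr => x _; apply: eq_bigr => y _.
  rewrite pair_bigA /=; under [RHS]eq_bigr do rewrite -mulrA.
  rewrite -big_distrr /= /a; case: (_ \in K); rewrite ?mul0r // mul1r.
  rewrite -sum1_card natr_sum big_mkcond /=; apply: eq_bigr => -[x' y'] _.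
  by rewrite /= in_setI; case: (_ \in K); case: (_ \in nb _); rewrite ?mulr0 ?mul0r ?mulr1.
rewrite N R C -subr_ge0.
have -> (u v w t : int) : u - (v - w - t) = u + (-1) * v + w + t by int_ring.
rewrite -sum4Z -!sum4D.
apply: sum4_ge0 => x y x' y'; rewrite inE /= /g /dl (eq_sym x') (eq_sym y').
by case: (x == x'); case: (y == y'); case: (G x x'); case: (G y y').
Qed.

(** Averaging. In [edges_lower_bound] the rows and columns cost at most [k^2 / 8] altogether, and so
    does the linear term. Hence [Q^2] times the total degree is at least [3 k^2 / 4], whereas small
    neighbourhoods would allow at most [k^2 / 2]. *)
Lemma exists_large_nb :
  (forall x, #|[set p in K | p.1 == x]| * (64 * q ^ 3) <= 2 * #|K|)%N ->
  (forall y, #|[set p in K | p.2 == y]| * (64 * q ^ 3) <= 2 * #|K|)%N ->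
  (16 * q ^ 5 <= #|K|)%N ->
  exists2 v, v \in K & (#|K| <= 2 * q ^ 2 * #|K :&: nb v|)%N.
Proof.
move=> hrow hcol hK; apply/exists_inP; apply: contraT; rewrite negb_exists_in => /forall_inP h.
have q0 : (0 < q)%N by lia.
have k0 : (0 < #|K|)%N by apply: leq_trans hK; rewrite muln_gt0 expn_gt0 q0.
set k : int := (#|K|)%:R.
have kE : k = (#|K|)%:R by [].
have k_gt0 : 0 < k by rewrite ltr0n.
set D : int := \sum_(v in K) (#|K :&: nb v|)%:R.
have hD : 2%:R * Q ^+ 2 * D <= k ^+ 2.
  rewrite /D big_distrr /=.
  apply: (@le_trans _ _ (\sum_(v in K) k)); last by rewrite sumr_const -mulr_natr -kE expr2.
  apply: ler_sum => v vK; rewrite QE -natrX -!natrM ler_nat ltnW // ltnNge.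
  exact: h.
have hR : 64%:R * Q ^+ 3 * row_sq <= 2%:R * k ^+ 2.
  rewrite /row_sq expr2 {2}kE -cardK_row mulrA !big_distrr /=; apply: ler_sum => x _.
  rewrite expr2 mulrA; apply: ler_wpM2r; first by rewrite sumr_ge0.
  by rewrite sum_row QE -natrX kE -!natrM ler_nat mulnC.
have hC : 64%:R * Q ^+ 3 * col_sq <= 2%:R * k ^+ 2.
  rewrite /col_sq expr2 {2}kE -cardK_row exchange_big /= mulrA !big_distrr /=; apply: ler_sum => y _.
  rewrite expr2 mulrA; apply: ler_wpM2r; first by rewrite sumr_ge0.
  by rewrite sum_col QE -natrX kE -!natrM ler_nat mulnC.
have hk : 16%:R * Q ^+ 5 <= k by rewrite QE -natrX -natrM ler_nat.
have := edges_lower_bound; have := sum_nb_lower_bound; rewrite -/D -kE.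
set E := sum4 _ => hE1 hE2.
have R0 : 0 <= row_sq by apply: sumr_ge0 => *; apply: sqr_ge0.
have C0 : 0 <= col_sq by apply: sumr_ge0 => *; apply: sqr_ge0.
have Q2 : 0 < Q ^+ 2 by rewrite exprn_gt0.
have Q23 : Q ^+ 2 <= Q ^+ 3.
  by rewrite -[X in X <= _]mulr1 [X in _ <= X]exprSr ler_wpM2l ?ltW // QE ltr1n.
have a1 : Q ^+ 2 * (E - row_sq - col_sq) <= Q ^+ 2 * D by apply: ler_wpM2l; [exact: ltW |].
have a2 : 0 <= (Q ^+ 3 - Q ^+ 2) * (row_sq + col_sq).
  by apply: mulr_ge0; [rewrite subr_ge0 | apply: addr_ge0].
have a3 : 16%:R * Q ^+ 5 * k <= k ^+ 2 by rewrite expr2; apply: ler_wpM2r; [exact: ltW |].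
have a4 : 0 < k ^+ 2 by rewrite exprn_gt0.
by move: hE2 hD hR hC a1 a2 a3 a4; lra.
Qed.

End Edges.

(** A container is a small set of pairs together with a set of rows and a set of columns that are
    contained in it entirely. *)
Definition in_container (c : {set X * X} * ({set X} * {set X})) (p : X * X) :=
  [|| p \in c.1, p.1 \in c.2.1 | p.2 \in c.2.2].

Definition heavy (f : X * X -> X) (A : {set X * X}) : {set X} :=
  [set x | #|A| < #|[set p in A | f p == x]| * (64 * q ^ 3)]%N.

(** The fibres of [f] are disjoint, and each heavy one takes more than the fraction [1 / (64 q^3)]
    of [A]. *)
Lemma card_heavy f (A : {set X * X}) : (0 < #|A|)%N -> (#|heavy f A| <= 64 * q ^ 3)%N.
Proof.
move=> A0; rewrite -(leq_pmul2r A0) -sum_nat_const.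
apply: (@leq_trans (\sum_(x in heavy f A) #|[set p in A | f p == x]| * (64 * q ^ 3))%N).
  by apply: leq_sum => x; rewrite inE => /ltnW.
rewrite -big_distrl /= mulnC leq_mul2l; apply/orP; right.
have -> : #|A| = (\sum_x #|[set p in A | f p == x]|)%N.
  rewrite -sum1_card (partition_big f predT) //=; apply: eq_bigr => x _.
  by rewrite -sum1_card; apply: eq_bigl => p; rewrite !inE.
by rewrite [X in (_ <= X)%N](bigID (mem (heavy f A))) /= leq_addr.
Qed.

(* Kleitman--Winston: branch on whether a vertex of large degree in the
   balanced part of [A] is used; heavy rows and columns are set aside. *)
Lemma containers (n t h : nat) (A : {set X * X}) :
  (#|A| <= n)%N -> (#|A| * (4 * q ^ 2 - 1) ^ t <= 32 * q ^ 5 * (4 * q ^ 2) ^ t)%N ->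
  (#|A| < 2 ^ h)%N ->
  exists C : seq ({set X * X} * ({set X} * {set X})),
  [/\ (size C <= n.+1 ^ t)%N,
      forall c, c \in C -> [/\ #|c.1| <= 32 * q ^ 5, #|c.2.1| <= h * (64 * q ^ 3)
                             & #|c.2.2| <= h * (64 * q ^ 3)]%N
    & forall (J : finType) (z : J -> X * X) (U : {set J}) (d : nat),
      (forall i, i \in U -> #|[set j in U | z j \in nb (z i)]| <= d)%N ->
      (forall i, i \in U -> z i \in A) ->
      exists2 c, c \in C & (#|[set i in U | ~~ in_container c (z i)]| <= t * d)%N].
Proof.
(* [n] bounds the size of [A] and drives the induction. [t] bounds how often a chosen vertex is
   used, each use shrinking [A] by the factor [1 - 1 / (4 q^2)]; [h] bounds how often [A] is
   halved. *)
elim: n t h A => [|n IH] t h A cA ht hh; case: (leqP #|A| (32 * q ^ 5)) => hA.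
- exists [:: (A, (set0, set0))]; split=> [|c|J z U d _ zA]; first by rewrite exp1n.
    by rewrite inE => /eqP ->; rewrite /= !cards0 hA !leq0n.
  exists (A, (set0, set0)); first by rewrite inE.
  rewrite (_ : [set _ in _ | _] = set0) ?cards0 //; apply/setP => i; rewrite !inE.
  by apply/negP => /andP[/zA zi]; rewrite /in_container /= zi.
- by move: hA; rewrite ltnNge (leq_trans cA).
- exists [:: (A, (set0, set0))]; split=> [|c|J z U d _ zA]; first by rewrite expn_gt0.
    by rewrite inE => /eqP ->; rewrite /= !cards0 hA !leq0n.
  exists (A, (set0, set0)); first by rewrite inE.
  rewrite (_ : [set _ in _ | _] = set0) ?cards0 //; apply/setP => i; rewrite !inE.
  by apply/negP => /andP[/zA zi]; rewrite /in_container /= zi.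
have A0 : (0 < #|A|)%N by apply: leq_ltn_trans hA.
case: t ht => [|t] ht; first by move: ht; rewrite !expn0 !muln1 leqNgt hA.
pose K := [set p in A | (p.1 \notin heavy fst A) && (p.2 \notin heavy snd A)].
have KA : K \subset A by apply/subsetP => p; rewrite inE => /andP[].
(* If the heavy rows and columns cover more than half of [A], they are put into the container and
   the construction continues in [K], at the cost of one halving. *)
case: (ltnP (2 * #|K|) #|A|) => hK.
  case: h hh => [|h] hh; first by move: hh; rewrite expn0 ltnS leqNgt A0.
  have [] := IH t.+1 h K.
  - by lia.
  - by apply: leq_trans ht; rewrite leq_mul2r subset_leq_card // orbT.
  - by move: hh; rewrite expnS; lia.
  move=> C [sC hC hU].
  exists [seq (c.1, (heavy fst A :|: c.2.1, heavy snd A :|: c.2.2)) | c <- C]; split.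
  - by rewrite size_map (leq_trans sC) // leq_exp2r.
  - move=> _ /mapP[c /hC[h1 h2 h3] ->] /=; rewrite h1 mulSn; split=> //.
      by apply: leq_trans (leq_card_setU _ _) _; rewrite leq_add // card_heavy.
    by apply: leq_trans (leq_card_setU _ _) _; rewrite leq_add // card_heavy.
  - move=> J z U d hd zA.
    have [] := hU J z [set i in U | z i \in K] d.
    + move=> i; rewrite inE => /andP[iU _]; apply: leq_trans (hd i iU).
      by apply/subset_leq_card/subsetP => j; rewrite !inE -andbA => /and3P[-> _ ->].
    + by move=> i; rewrite inE => /andP[].
    move=> c cC hc; exists (c.1, (heavy fst A :|: c.2.1, heavy snd A :|: c.2.2)).
      by apply/mapP; exists c.
    apply: leq_trans hc; apply/subset_leq_card/subsetP => i.
    rewrite !inE /in_container /= !inE => /andP[iU].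
    by rewrite !negb_or -!andbA => /and5P[-> -> -> -> ->]; rewrite iU zA.
(* Otherwise [K] is balanced: its fibres lie in light fibres of [A], and [#|A| <= 2 * #|K|]. *)
have [] := @exists_large_nb K.
- move=> x; apply: leq_trans hK; have [xI|xI] := boolP (x \in heavy fst A).
    rewrite (_ : [set _ in _ | _] = set0) ?cards0 //; apply/setP => p; rewrite in_set0 in_set.
    by apply/negP => /andP[pK /eqP e]; move: pK; rewrite in_set e xI ?andbF.
  move: xI; rewrite inE -leqNgt; apply: leq_trans; rewrite leq_mul2r subset_leq_card ?orbT //.
  by apply/subsetP => p; rewrite !inE => /andP[/andP[-> _] ->].
- move=> x; apply: leq_trans hK; have [xI|xI] := boolP (x \in heavy snd A).
    rewrite (_ : [set _ in _ | _] = set0) ?cards0 //; apply/setP => p; rewrite in_set0 in_set.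
    by apply/negP => /andP[pK /eqP e]; move: pK; rewrite in_set e xI ?andbF.
  move: xI; rewrite inE -leqNgt; apply: leq_trans; rewrite leq_mul2r subset_leq_card ?orbT //.
  by apply/subsetP => p; rewrite !inE => /andP[/andP[-> _] ->].
- by lia.
move=> v vK hv; have vA : v \in A by apply: (subsetP KA).
have hN : (#|A| <= 4 * q ^ 2 * #|A :&: nb v|)%N.
  have : (#|K :&: nb v| <= #|A :&: nb v|)%N by apply/subset_leq_card/setSI.
  by move: (q ^ 2)%N hv => s; nia.
have N0 : (0 < #|A :&: nb v|)%N by move: (leq_trans A0 hN); rewrite !muln_gt0 => /andP[].
have cD : #|A :\: nb v| = (#|A| - #|A :&: nb v|)%N by rewrite cardsD.
have cD1 := cardsD1 v A; rewrite vA in cD1.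
(* Branch where no [z i] equals [v]: only [v] is removed, and [t] does not decrease. *)
have [] := IH t.+1 h (A :\ v).
- by lia.
- by apply: leq_trans ht; rewrite leq_mul2r cD1 leq_addl orbT.
- by lia.
move=> C1 [s1 c1 u1].
have q2 : (0 < 4 * q ^ 2)%N by rewrite muln_gt0 expn_gt0; lia.
(* Branch where some [z i] equals [v]: at most [d] indices have their pair in [nb v]; they are given
   up, and all the others lie in the smaller set. *)
have [] := IH t h (A :\: nb v).
- by lia.
- rewrite -(leq_pmul2l q2) mulnA.
  apply: (@leq_trans (#|A| * (4 * q ^ 2 - 1) * (4 * q ^ 2 - 1) ^ t)%N).
    rewrite leq_mul2r; apply/orP; right; rewrite cD.
    by move: (4 * q ^ 2)%N q2 hN => s; nia.
  rewrite -[(_ * _ * _ ^ t)%N]mulnA -expnS; apply: (leq_trans ht).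
  by rewrite (expnS _ t) mulnCA.
- by lia.
move=> C2 [s2 c2 u2].
exists (C1 ++ C2); split.
- rewrite size_cat; apply: (leq_trans (leq_add s1 s2)).
  rewrite [X in (_ <= X)%N]expnSr [X in (X + _ <= _)%N]expnSr.
  have : (n.+1 ^ t <= n.+2 ^ t)%N by case: (t) => // t'; rewrite leq_exp2r.
  by move: (n.+1 ^ t)%N (n.+2 ^ t)%N => a b; nia.
- by move=> c; rewrite mem_cat => /orP[/c1|/c2].
move=> J z U d hd zA; have [/exists_inP[i iU /eqP zi]|nv] := boolP [exists i in U, z i == v].
  have [] := u2 J z [set j in U | z j \notin nb v] d.
  + move=> j; rewrite inE => /andP[jU _]; apply: leq_trans (hd j jU).
    by apply/subset_leq_card/subsetP => k; rewrite !inE -andbA => /and3P[-> _ ->].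
  + by move=> j; rewrite inE => /andP[jU jv]; rewrite inE jv zA.
  move=> c cC hc; exists c; first by rewrite mem_cat cC orbT.
  rewrite mulSn; apply: leq_trans (leq_add (hd i iU) hc).
  apply: leq_trans (leq_card_setU _ _); apply/subset_leq_card/subsetP => j.
  by rewrite !inE zi => /andP[-> ->]; rewrite andbT orbN.
have [] := u1 J z U d hd.
  move=> i iU; rewrite !inE zA // andbT.
  by move: nv; rewrite negb_exists_in => /forall_inP /(_ i iU).
by move=> c cC hc; exists c => //; rewrite mem_cat cC.
Qed.

End Containers.

(** * Random samples *)

Section Sampling.
Variables (V X : finType).
Implicit Types (J : {set V}) (phi : V -> V) (f : {ffun V -> X}).

(** The union bound, with probabilities written as fractions of denominator [w]. *)
Lemma card_union (T I : finType) (F : I -> {set T}) (D : {set I}) w k :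
  (forall i, i \in D -> #|F i| * w <= k) -> #|\bigcup_(i in D) F i| * w <= #|D| * k.
Proof.
move=> h; rewrite -[X in _ <= X]sum_nat_const.
pose K (A : {set T}) m : Prop := #|A| * w <= m; rewrite -/(K _ _).
apply: (big_rec2 K) => [|i m A iD hA]; rewrite /K; first by rewrite cards0 mul0n.
apply: leq_trans (leq_mul (leq_card_setU _ _) (leqnn w)) _.
by rewrite mulnDl leq_add // h.
Qed.

(** A uniformly random map sends [J] into [I] with probability [(#|I| / #|X|)^#|J|]. For the count,
    [f] is split into its restrictions to [J] and to the complement, each padded with [x0]. *)
Lemma card_ffun_in J (I : {set X}) :
  #|[set f : {ffun V -> X} | [forall v in J, f v \in I]]| * #|X| ^ #|J| <= #|I| ^ #|J| * #|X| ^ #|V|.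
Proof.
have [->|/set0Pn[f0 _]] := eqVneq [set f : {ffun V -> X} | [forall v in J, f v \in I]] set0.
  by rewrite cards0 mul0n.
have [x0|V0] := pickP X; last first.
  rewrite (_ : #|J| = 0) ?expn0 ?mul1n ?muln1.
    by rewrite -card_ffun max_card.
  by apply/eqP; rewrite cards_eq0; apply/eqP/setP => v; have := V0 (f0 v).
move=> _; have -> : #|X| ^ #|V| = #|X| ^ #|~: J| * #|X| ^ #|J|.
  by rewrite -expnD addnC cardsC.
rewrite mulnA leq_mul2r; apply/orP; right.
pose g f : {ffun V -> X} * {ffun V -> X} :=
  ([ffun v => if v \in J then f v else x0], [ffun v => if v \in J then x0 else f v]).
have ginj : injective g.
  move=> f f' [/ffunP e1 /ffunP e2]; apply/ffunP => v.
  by move: (e1 v) (e2 v); rewrite !ffunE; case: ifP.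
rewrite -(card_imset _ ginj).
have -> : #|I| ^ #|J| * #|X| ^ #|~: J| =
  #|setX [set h in pffun_on x0 (mem J) (mem I)] [set h in pffun_on x0 (mem (~: J)) predT]|.
  by rewrite cardsX; congr (_ * _); rewrite [RHS]cardsE card_pffun_on.
apply/subset_leq_card/subsetP => y /imsetP[f]; rewrite inE => /forall_inP hf -> {y}.
rewrite inE /= !inE; apply/andP; split; apply/pffun_onP; split.
- by apply/subsetP => v; rewrite inE ffunE; case: ifP => //; rewrite eqxx.
- by move=> _ /imageP[v vJ ->]; rewrite ffunE; have vJ' : v \in J by []; rewrite vJ'; apply: hf.
- by apply/subsetP => v; rewrite !inE ffunE; case: ifP => //; rewrite eqxx.
- by [].
Qed.

(** Union bound over the [s]-subsets of [V] that [f] may send into [I]. *)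
Lemma card_ffun_many (I : {set X}) s :
  #|[set f : {ffun V -> X} | s <= #|[set v | f v \in I]|]| * #|X| ^ s
  <= 'C(#|V|, s) * (#|I| ^ s * #|X| ^ #|V|).
Proof.
set S := [set f | _].
pose D := [set J : {set V} | #|J| == s].
have sub : S \subset \bigcup_(J in D) [set f : {ffun V -> X} | [forall v in J, f v \in I]].
  apply/subsetP => f; rewrite inE => hs.
  have : 0 < #|[set J : {set V} | J \subset [set v | f v \in I] & #|J| == s]|.
    by rewrite cards_draws bin_gt0.
  case/card_gt0P => J; rewrite inE => /andP[/subsetP sJ cJ].
  apply/bigcupP; exists J; rewrite inE //; apply/forall_inP => v /sJ; by rewrite inE.
apply: leq_trans (leq_mul (subset_leq_card sub) (leqnn _)) _.
rewrite -card_draws; apply: card_union => J; rewrite inE => /eqP <-.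
exact: card_ffun_in.
Qed.

(** The vertices [i] and [phi i], for [i] in [J], are all distinct, so the pairs of their images are
    independent and uniform in [X * X]. *)
Lemma card_ffun_pairs J phi (A : {set X * X}) :
  {in J &, injective phi} -> (forall i, i \in J -> phi i \notin J) ->
  #|[set f : {ffun V -> X} | [forall i in J, (f i, f (phi i)) \in A]]| * #|X| ^ (2 * #|J|)
  <= #|A| ^ #|J| * #|X| ^ #|V|.
Proof.
move=> pinj pJ.
have [->|/set0Pn[f0 _]] := eqVneq [set f : {ffun V -> X} | [forall i in J, (f i, f (phi i)) \in A]] set0.
  by rewrite cards0 mul0n.
have [x0|V0] := pickP X; last first.
  rewrite (_ : #|J| = 0) ?muln0 ?expn0 ?mul1n ?muln1.
    by rewrite -card_ffun max_card.
  by apply/eqP; rewrite cards_eq0; apply/eqP/setP => v; have := V0 (f0 v).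
move=> _; pose W := J :|: phi @: J.
have cW : #|W| = 2 * #|J|.
  rewrite cardsU (_ : J :&: phi @: J = set0) ?cards0 ?subn0 ?card_in_imset //; first by lia.
  apply/setP => v; rewrite !inE; apply/negP => /andP[vJ /imsetP[i iJ e]].
  by have := pJ i iJ; rewrite -e vJ.
rewrite -cW; have -> : #|X| ^ #|V| = #|X| ^ #|~: W| * #|X| ^ #|W|.
  by rewrite -expnD addnC cardsC.
rewrite mulnA leq_mul2r; apply/orP; right.
pose g f : {ffun V -> X * X} * {ffun V -> X} :=
  ([ffun v => if v \in J then (f v, f (phi v)) else (x0, x0)],
   [ffun v => if v \in W then x0 else f v]).
have ginj : injective g.
  move=> f f' [/ffunP e1 /ffunP e2]; apply/ffunP => v.
  have [vW|vW] := boolP (v \in W); last by move: (e2 v); rewrite !ffunE (negbTE vW).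
  move: vW; rewrite inE => /orP[vJ|/imsetP[i iJ ->]].
    by move: (e1 v); rewrite !ffunE vJ => -[].
  by move: (e1 i); rewrite !ffunE iJ => -[].
rewrite -(card_imset _ ginj).
have -> : #|A| ^ #|J| * #|X| ^ #|~: W| =
  #|setX [set h in pffun_on (x0, x0) (mem J) (mem A)] [set h in pffun_on x0 (mem (~: W)) predT]|.
  by rewrite cardsX; congr (_ * _); rewrite [RHS]cardsE card_pffun_on.
apply/subset_leq_card/subsetP => y /imsetP[f]; rewrite inE => /forall_inP hf -> {y}.
rewrite inE /= inE [X in _ && X]inE; apply/andP; split; apply/pffun_onP; split.
- by apply/subsetP => v; rewrite inE ffunE; case: ifP => //; rewrite eqxx.
- by move=> _ /imageP[v vJ ->]; rewrite ffunE; have vJ' : v \in J by []; rewrite vJ'; apply: hf.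
- by apply/subsetP => v; rewrite inE ffunE in_setC; case: ifP => //; rewrite eqxx.
- by [].
Qed.

(** Fixing the value [v0] outside the domain leaves one representative for each map on a [b]-set, so
    a union bound costs about [n^b] instead of [n^n]. *)
Definition partial_maps (v0 : V) (b : nat) : {set {set V} * {ffun V -> V}} :=
  [set p : {set V} * {ffun V -> V} | (#|p.1| == b) && (p.2 \in pffun_on v0 (mem p.1) predT)].

Lemma card_partial_maps v0 b : #|partial_maps v0 b| <= 2 ^ #|V| * #|V| ^ b.
Proof.
have -> : partial_maps v0 b =
    \bigcup_(J in [set J : {set V} | #|J| == b]) setX [set J] [set h in pffun_on v0 (mem J) predT].
  apply/setP => -[J h]; rewrite inE /=; apply/andP/bigcupP.
    by case=> h1 h2; exists J; rewrite !inE ?eqxx.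
  by case=> J'; rewrite inE => h1; rewrite !inE => /andP[/eqP /= -> ->].
rewrite -[X in X <= _]muln1; apply: leq_trans (card_union (k := #|V| ^ b) _) _.
  move=> J; rewrite inE => /eqP <-.
  by rewrite muln1 cardsX cards1 mul1n cardsE card_pffun_on.
rewrite leq_mul2r; apply/orP; right.
rewrite -cardsT -card_powerset; apply/subset_leq_card/subsetP => J _.
by rewrite powersetE subsetT.
Qed.

Lemma restrict_partial_map v0 J (phi : V -> V) :
  (J, [ffun v => if v \in J then phi v else v0]) \in partial_maps v0 #|J|.
Proof.
rewrite inE eqxx; apply/pffun_onP; split=> //.
by apply/subsetP => v; rewrite inE ffunE; case: ifP => //; rewrite eqxx.
Qed.

End Sampling.

Lemma bin_le_exp n m : 'C(n, m) <= n ^ m.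
Proof.
apply: (@leq_trans (n ^_ m)); first by rewrite -bin_ffact leq_pmulr ?fact_gt0.
elim: m => // m IH; rewrite ffactnSr expnSr leq_mul //; exact: leq_subr.
Qed.

Lemma bin_le_pow2 n m : 'C(n, m) <= 2 ^ n.
Proof.
rewrite -(card_ord n) -card_draws -cardsT -card_powerset.
by apply/subset_leq_card/subsetP => J _; rewrite powersetE subsetT.
Qed.

(** For distinct adjacent points of the affine polar graph this common neighbourhood is the affine
    line through them, both points included. *)
Definition line (X : finType) (G : rel X) (x y : X) := [set z | G x z && G z y].

(** * Three bad events for a random map, each of probability below 1/3 *)

Section GoodSample.
Variables (X : finType) (q : nat) (G : rel X).
Hypotheses (q_gt1 : 1 < q) (Gsym : symmetric G) (Grefl : reflexive G).
Hypothesis cardX : #|X| = q ^ 4.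
Hypothesis codegG : forall x y, #|[set z | G x z && G z y]| =
  if x == y then q ^ 3 - q ^ 2 + q else if G x y then q else q ^ 2 - q.

Lemma card_line x y : x != y -> G x y -> #|line G x y| = q.
Proof. by move=> xy Gxy; rewrite codegG (negbTE xy) Gxy. Qed.

Variables (V : finType) (v0 : V) (t h s mu : nat).
Let n := #|V|.
Let cc := (q ^ 8).+1 ^ t.
Definition common_edges (f : V -> X) (B : {set V}) (phi : V -> V) : {set V * V} :=
  [set e | [&& e.1 \in B, e.2 \in B & (f e.2, f (phi e.2)) \in nb G (f e.1, f (phi e.1))]].

Let q0 : 0 < q. Proof. exact: ltnW. Qed.
Let N0 : 0 < #|X| ^ n. Proof. by rewrite cardX !expn_gt0 q0. Qed.

Let small (S : {set {ffun V -> X}}) a b w : #|S| * w <= a * (b * #|X| ^ n) ->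
  3 * (a * b) < w -> 3 * #|S| < #|X| ^ n.
Proof.
move=> h1 h2; have w0 : 0 < w by apply: leq_ltn_trans h2.
rewrite -(ltn_pmul2r w0); apply: (@leq_ltn_trans (3 * (a * b) * #|X| ^ n)).
  by rewrite -!mulnA leq_mul2l.
by rewrite mulnC ltn_pmul2l.
Qed.

(** There are at most [q^8] lines with [q] points each, and twelve vertices fall on a given one with
    probability at most [n^12 q^(-36)]. *)
Lemma few_heavy_lines : 3 * n ^ 12 < q ^ 28 -> 3 * #|\bigcup_(xy in [set xy : X * X | (xy.1 != xy.2) && G xy.1 xy.2])
  [set f : {ffun V -> X} | 12 <= #|[set v | f v \in line G xy.1 xy.2]|]| < #|X| ^ n.
Proof.
move=> num1; apply: (@small _ (q ^ 8) (n ^ 12 * q ^ 12) (#|X| ^ 12)).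
  apply: leq_trans (card_union (k := n ^ 12 * q ^ 12 * #|X| ^ n) _) _.
    move=> [x y]; rewrite inE /= => /andP[xy Gxy].
    apply: leq_trans (card_ffun_many _ _ _) _.
    by rewrite card_line // mulnA leq_mul2r leq_mul2r bin_le_exp !orbT.
  rewrite leq_mul2r; apply/orP; right; apply: leq_trans (max_card _) _.
  by rewrite card_prod cardX -expnD.
rewrite cardX -expnM (_ : 4 * 12 = 8 + 12 + 28) // !expnD.
have Q : 0 < q ^ 8 * q ^ 12 by rewrite muln_gt0 !expn_gt0 q0.
have bound := num1; rewrite -(ltn_pmul2l Q) in bound.
by apply: leq_ltn_trans bound; rewrite leq_eqVlt; apply/orP; left; apply/eqP; ring.
Qed.

Variable C : seq ({set X * X} * ({set X} * {set X})).
Hypothesis sC : size C <= cc.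
Hypothesis hC : forall c, c \in C -> [/\ #|c.1| <= 32 * q ^ 5,
  #|c.2.1| <= h * (64 * q ^ 3) & #|c.2.2| <= h * (64 * q ^ 3)].

Let cardC : #|[set c in C]| <= cc.
Proof. by rewrite cardsE (leq_trans (card_size _)). Qed.

(** The rows of a container form a fraction at most [64 h / q] of [X], and so do its columns; the
    union is over the two sides and all containers. *)
Lemma few_heavy_sides : 6 * 2 ^ n * cc * (64 * h) ^ s < q ^ s -> 3 * #|\bigcup_(c in [set c in C])
  ([set f : {ffun V -> X} | s <= #|[set v | f v \in c.2.1]|] :|:
   [set f : {ffun V -> X} | s <= #|[set v | f v \in c.2.2]|])| < #|X| ^ n.
Proof.
move=> num2; pose b := 2 * 2 ^ n * (h * (64 * q ^ 3)) ^ s.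
have b1 (I : {set X}) : #|I| <= h * (64 * q ^ 3) ->
  #|[set f : {ffun V -> X} | s <= #|[set v | f v \in I]|]| * #|X| ^ s <=
  2 ^ n * (h * (64 * q ^ 3)) ^ s * #|X| ^ n.
  move=> hI; apply: leq_trans (card_ffun_many _ _ _) _; rewrite mulnA leq_mul2r.
  apply/orP; right; apply: leq_mul; first exact: bin_le_pow2.
  by case: (s) => // s'; rewrite leq_exp2r.
apply: (@small _ cc b (#|X| ^ s)).
  apply: leq_trans (card_union (k := b * #|X| ^ n) _) _.
    move=> c; rewrite inE => /hC[_ h1 h2].
    apply: leq_trans (leq_mul (leq_card_setU _ _) (leqnn _)) _.
    rewrite mulnDl; apply: leq_trans (leq_add (b1 _ h1) (b1 _ h2)) _.
    by rewrite addnn -mul2n /b !mulnA.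
  by rewrite leq_mul2r cardC orbT.
have Q : 0 < q ^ (3 * s) by rewrite expn_gt0 q0.
have bound := num2; rewrite -(ltn_pmul2l Q) in bound.
have -> : #|X| ^ s = q ^ (3 * s) * q ^ s by rewrite cardX -expnM -expnD; congr (_ ^ _); lia.
apply: leq_ltn_trans bound; rewrite leq_eqVlt; apply/orP; left; apply/eqP.
rewrite /b !expnMn (mulnC 3 s) expnM; move: (2 ^ n) cc (64 ^ s) (h ^ s) (q ^ s) => a1 a2 a3 a4 a5.
by ring.
Qed.

(** The event that all pairs of the matching [p] fall into [A]. It is empty if [p] is not a
    matching, so that the union may range over all partial maps. *)
Let captured (p : {set V} * {ffun V -> V}) (A : {set X * X}) : {set {ffun V -> X}} :=
  if [forall i in p.1, forall j in p.1, (p.2 i == p.2 j) ==> (i == j)] &&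
     [forall i in p.1, p.2 i \notin p.1]
  then [set f : {ffun V -> X} | [forall i in p.1, (f i, f (p.2 i)) \in A]] else set0.

(** A container has density at most [32 q^(-3)] in [X * X], so [5 mu] pairs are captured with
    probability at most [(32 q^(-3))^(5 mu)]. The union is over all partial maps and all
    containers. *)
Lemma few_captured :
  3 * 2 ^ n * cc * n ^ (5 * mu) * 32 ^ (5 * mu) < q ^ (15 * mu) -> 3 * #|\bigcup_(pc in setX (partial_maps v0 (5 * mu)) [set c in C])
  captured pc.1 pc.2.1| < #|X| ^ n.
Proof.
move=> num3; pose b := (32 * q ^ 5) ^ (5 * mu).
apply: (@small _ (2 ^ n * n ^ (5 * mu) * cc) b (#|X| ^ (2 * (5 * mu)))).
  apply: leq_trans (card_union (k := b * #|X| ^ n) _) _.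
    move=> [p c]; rewrite !inE /= => /andP[/andP[/eqP cp _] /hC[h1 _ _]].
    rewrite /captured; case: ifP => [/andP[/forall_inP i1 /forall_inP i2]|]; last by rewrite cards0.
    rewrite -cp; apply: leq_trans (card_ffun_pairs _ _ _) _ => //.
      move=> i j ip jp /eqP e; have /forall_inP /(_ j jp) /implyP /(_ e) /eqP := i1 i ip.
      by [].
    rewrite leq_mul2r /b -cp; apply/orP; right.
    by case: (#|p.1|) => // k; rewrite leq_exp2r.
  rewrite leq_mul2r cardsX; apply/orP; right.
  by apply: leq_mul => //; apply: card_partial_maps.
have Q : 0 < q ^ (25 * mu) by rewrite expn_gt0 q0.
have bound := num3; rewrite -(ltn_pmul2l Q) in bound.
have -> : #|X| ^ (2 * (5 * mu)) = q ^ (25 * mu) * q ^ (15 * mu).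
  by rewrite cardX -expnM -expnD; congr (_ ^ _); lia.
apply: leq_ltn_trans bound; rewrite leq_eqVlt; apply/orP; left; apply/eqP.
rewrite /b expnMn -expnM (_ : 5 * (5 * mu) = 25 * mu); last by lia.
move: (2 ^ n) cc (n ^ (5 * mu)) (32 ^ (5 * mu)) (q ^ (25 * mu)) => a1 a2 a3 a4 a5.
by ring.
Qed.

End GoodSample.

Section GoodSampleExists.
Variables (X : finType) (q : nat) (G : rel X).
Hypotheses (q_gt1 : 1 < q) (Gsym : symmetric G) (Grefl : reflexive G).
Hypothesis cardX : #|X| = q ^ 4.
Hypothesis codegG : forall x y, #|[set z | G x z && G z y]| =
  if x == y then q ^ 3 - q ^ 2 + q else if G x y then q else q ^ 2 - q.

Lemma exists_subset_card (T : finType) (A : {set T}) k : k <= #|A| ->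
  exists2 J : {set T}, J \subset A & #|J| = k.
Proof.
move=> h; have : 0 < #|[set J : {set T} | J \subset A & #|J| == k]|.
  by rewrite cards_draws bin_gt0.
by case/card_gt0P => J; rewrite inE => /andP[JA /eqP]; exists J.
Qed.

Lemma three_small a b c ab abc w k : 3 * a < w -> 3 * b < w -> 3 * c < w ->
  ab <= a + b -> abc <= ab + c -> abc + k = w -> 0 < k.
Proof. lia. Qed.

(** Four of the five parts covering the [6 mu] elements have size at most [mu / 4] each, which
    leaves [5 mu] for [j]. *)
Lemma six_parts mu td s a1 a2 a3 a4 j u2 u3 u4 u5 : 6 * mu <= u5 ->
  u5 <= u4 + a4 -> u4 <= u3 + a3 -> u3 <= u2 + j -> u2 <= a1 + a2 ->
  4 * a1 < mu -> a2 <= td -> a3 < s -> a4 < s -> 4 * td <= mu -> 4 * s <= mu ->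
  5 * mu <= j.
Proof. lia. Qed.

(** Any map outside the three bad events works. If a matching had few common edges, most of its
    pairs would have degree at most [d], so some container would hold nearly all of these. As few
    pairs are caught by its rows and columns, [5 mu] pairs would be captured by its small set. *)
Lemma exists_good_sample (V : finType) (v0 : V) (t h s mu d : nat) :
  q ^ 8 * (4 * q ^ 2 - 1) ^ t <= 32 * q ^ 5 * (4 * q ^ 2) ^ t -> q ^ 8 < 2 ^ h ->
  3 * #|V| ^ 12 < q ^ 28 ->
  6 * 2 ^ #|V| * (q ^ 8).+1 ^ t * (64 * h) ^ s < q ^ s ->
  3 * 2 ^ #|V| * (q ^ 8).+1 ^ t * #|V| ^ (5 * mu) * 32 ^ (5 * mu) < q ^ (15 * mu) ->
  4 * (t * d) <= mu -> 4 * s <= mu -> 0 < d ->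
  exists f : {ffun V -> X},
    (forall x y, x != y -> G x y -> #|[set v | f v \in line G x y]| < 12) /\
    (forall (B : {set V}) (phi : V -> V), #|B| = 6 * mu -> {in B &, injective phi} ->
      (forall i, i \in B -> phi i \notin B) -> mu * d <= 4 * #|common_edges G f B phi|).
Proof.
move=> ht hh num1 num2 num3 num4 num5 d0.
have cT : #|[set: X * X]| = q ^ 8 by rewrite cardsT card_prod cardX -expnD.
have [] := @containers X q G q_gt1 Gsym Grefl cardX codegG (q ^ 8) t h setT;
  rewrite ?cT // => C [sC hC hU].
have s1 := few_heavy_lines q_gt1 cardX codegG num1.
have s2 := few_heavy_sides q_gt1 cardX sC hC num2.
have s3 := few_captured q_gt1 cardX v0 sC hC num3.
move: s1 s2 s3; set S1 := \bigcup_(i in _) _; set S2 := \bigcup_(i in _) _.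
set S3 := \bigcup_(i in _) _ => s1 s2 s3.
have : 0 < #|~: (S1 :|: S2 :|: S3)|.
  apply: (three_small s1 s2 s3 (leq_card_setU S1 S2) (leq_card_setU (S1 :|: S2) S3)).
  by rewrite cardsC card_ffun.
case/card_gt0P => f; rewrite !inE !negb_or -andbA => /and3P[f1 f2 f3].
exists f; split=> [x y xy Gxy|B phi cB pinj pB].
  rewrite ltnNge; apply: contra f1 => hl; apply/bigcupP.
  by exists (x, y); rewrite inE //= xy.
rewrite leqNgt; apply/negP => few.
pose z i := (f i, f (phi i)).
pose deg i := #|[set j in B | z j \in nb G (z i)]|.
have edgesE : #|common_edges G f B phi| = \sum_(i in B) deg i.
  rewrite -sum1_card (eq_bigr (fun i => \sum_(j | (j \in B) && (z j \in nb G (z i))) 1)); last first.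
    by move=> i _; rewrite /deg -sum1_card; apply: eq_bigl => j; rewrite inE.
  by rewrite pair_big_dep /=; apply: eq_bigl => e; rewrite inE.
(* The degrees sum to less than [mu * d / 4], so fewer than [mu / 4] of them exceed [d]. *)
pose U := [set i in B | deg i <= d].
have hBU : 4 * #|B :\: U| < mu.
  rewrite -(ltn_pmul2r d0) -mulnA; apply: leq_ltn_trans few.
  rewrite leq_mul2l edgesE -sum_nat_const /=.
  rewrite [X in _ <= X](big_setID U) /= addnC.
  apply: (@leq_trans (\sum_(i in B :\: U) deg i)); last exact: leq_addr.
  apply: leq_sum => i; rewrite in_setD in_set => /andP[h1 iB].
  by move: h1; rewrite iB -ltnNge; exact: ltnW.
have [] := hU V z U d.
- move=> i; rewrite inE => /andP[iB]; apply: leq_trans.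
  by apply/subset_leq_card/subsetP => j; rewrite !inE -andbA => /and3P[-> _ ->].
- by move=> i _; rewrite inE.
move=> c cC hbad.
have side1 : #|[set v | f v \in c.2.1]| < s.
  rewrite ltnNge; apply: contra f2 => hl; apply/bigcupP.
  by exists c; rewrite !inE // hl.
have side2 : #|[set v | f v \in c.2.2]| < s.
  rewrite ltnNge; apply: contra f2 => hl; apply/bigcupP.
  by exists c; rewrite !inE // hl orbT.
have side3 : #|[set i in B | f (phi i) \in c.2.2]| < s.
  apply: leq_ltn_trans side2; rewrite -(card_in_imset (f := phi)).
    by apply/subset_leq_card/subsetP => y /imsetP[i]; rewrite inE => /andP[_ h1] -> {y}; rewrite inE.
  by move=> i j; rewrite !inE => /andP[iB _] /andP[jB _]; apply: pinj.
pose J0 := [set i in B | z i \in c.1].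
have hJ0 : 5 * mu <= #|J0|.
  have sub : B \subset (B :\: U) :|: [set i in U | ~~ in_container c (z i)] :|: J0 :|:
      [set v | f v \in c.2.1] :|: [set i in B | f (phi i) \in c.2.2].
    apply/subsetP => i iB; rewrite 4!in_setU in_setD iB andbT.
    have [iU|//] := boolP (i \in U); rewrite [_ \in [set i in U | _]]in_set iU /=.
    rewrite [_ \in [set v | _]]in_set [_ \in [set i in B | f _ \in _]]in_set [_ \in J0]in_set iB /=.
    by rewrite /in_container /=; case: (z i \in c.1); case: (f i \in c.2.1); case: (f (phi i) \in c.2.2).
  have := subset_leq_card sub; rewrite cB => cB'.
  apply: (six_parts cB' (leq_card_setU _ _) (leq_card_setU _ _) (leq_card_setU _ _)
            (leq_card_setU _ _) hBU hbad side1 side3 num4 num5).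
have [J JJ0 cJ] := exists_subset_card hJ0.
have JB i : i \in J -> i \in B by move/(subsetP JJ0); rewrite inE => /andP[].
case/negP: f3; apply/bigcupP.
exists ((J, [ffun v => if v \in J then phi v else v0]), c).
  by rewrite in_setX /= [c \in _]inE cC andbT -cJ restrict_partial_map.
rewrite /= ifT.
  rewrite inE; apply/forall_inP => i iJ; rewrite ffunE iJ.
  by move/(subsetP JJ0): iJ; rewrite inE => /andP[].
apply/andP; split; last first.
  apply/forall_inP => i iJ; rewrite ffunE iJ; apply: contra (pB i (JB i iJ)); exact: JB.
apply/forall_inP => i iJ; apply/forall_inP => j jJ; rewrite !ffunE iJ jJ.
by apply/implyP => /eqP /pinj -> //; apply: JB.
Qed.

End GoodSampleExists.

(** * Splitting the lines *)

Section Bits.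
Variables (P T : finType) (p1 p2 p3 p4 : T -> P).
Implicit Types (c : {ffun P -> bool}) (E : {set T}).

Definition split_pairs c (e : T) := (c (p1 e) != c (p2 e)) && (c (p3 e) != c (p4 e)).
Definition no_split E : {set {ffun P -> bool}} := [set c | [forall e in E, ~~ split_pairs c e]].
(* Flipping the bits at [p1 e] and [p3 e] can only affect [e'] if [e] touches [e']. *)
Definition touches (e e' : T) :=
  [|| p1 e == p1 e', p1 e == p2 e', p1 e == p3 e', p1 e == p4 e',
      p3 e == p1 e', p3 e == p2 e', p3 e == p3 e' | p3 e == p4 e'].

Let flip (x : P) c : {ffun P -> bool} := [ffun y => c y (+) (y == x)].

Let flipK x : involutive (flip x).
Proof. by move=> c; apply/ffunP => y; rewrite !ffunE addbK. Qed.

(* Flipping the bits at [p1 e] and [p3 e] splits the colourings into groups of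
   four, exactly one of which splits both pairs of [e]. *)
Lemma card_no_split_cons E e : p1 e != p2 e -> p3 e != p4 e -> p1 e != p3 e ->
  p1 e != p4 e -> p3 e != p2 e -> (forall e', e' \in E -> ~~ touches e e') ->
  4 * #|no_split (e |: E)| <= 3 * #|no_split E|.
Proof.
move=> n12 n34 n13 n14 n32 hE; set S := no_split E.
pose Gd := [set c in S | split_pairs c e].
have flip1 c : c \in S -> flip (p1 e) c \in S.
  rewrite !inE => /forall_inP h; apply/forall_inP => e' e'E.
  have := hE e' e'E; rewrite /touches !negb_or -?andbA ![p1 e == _]eq_sym.
  case/and5P => /negbTE h1 /negbTE h2 /negbTE h3 /negbTE h4 _.
  by have := h e' e'E; rewrite /split_pairs !ffunE h1 h2 h3 h4 !addbF.
have flip3 c : c \in S -> flip (p3 e) c \in S.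
  rewrite !inE => /forall_inP h; apply/forall_inP => e' e'E.
  have := hE e' e'E; rewrite /touches !negb_or -?andbA ![p3 e == _]eq_sym.
  case/and5P => _ _ _ _ /and4P[/negbTE h1 /negbTE h2 /negbTE h3 /negbTE h4].
  by have := h e' e'E; rewrite /split_pairs !ffunE h1 h2 h3 h4 !addbF.
have sub : S \subset Gd :|: flip (p1 e) @: Gd :|: flip (p3 e) @: Gd :|:
    (flip (p1 e) \o flip (p3 e)) @: Gd.
  apply/subsetP => c cS; rewrite !in_setU.
  have [a|a] := boolP (c (p1 e) != c (p2 e)); have [b|b] := boolP (c (p3 e) != c (p4 e)).
  - by rewrite [c \in Gd]inE cS /split_pairs a b.
  - have -> : c \in flip (p3 e) @: Gd; last by rewrite !orbT.
    apply/imsetP; exists (flip (p3 e) c); last by rewrite flipK.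
    rewrite inE flip3 // /split_pairs !ffunE eqxx (negbTE n13) [p2 e == _]eq_sym (negbTE n32).
    rewrite [p4 e == _]eq_sym (negbTE n34) !addbF addbT a /=.
    by move: b; rewrite negbK => /eqP ->; case: (c _).
  - have -> : c \in flip (p1 e) @: Gd; last by rewrite !orbT.
    apply/imsetP; exists (flip (p1 e) c); last by rewrite flipK.
    rewrite inE flip1 // /split_pairs !ffunE eqxx ![_ == p1 e]eq_sym.
    rewrite (negbTE n12) (negbTE n13) (negbTE n14) !addbF addbT b andbT.
    by move: a; rewrite negbK => /eqP ->; case: (c _).
  - have -> : c \in (flip (p1 e) \o flip (p3 e)) @: Gd; last by rewrite !orbT.
    apply/imsetP; exists (flip (p3 e) (flip (p1 e) c)); last by rewrite /= !flipK.
    rewrite inE flip3 ?flip1 // /split_pairs !ffunE !eqxx ![_ == p1 e]eq_sym.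
    rewrite (negbTE n12) (negbTE n13) (negbTE n14) [p2 e == _]eq_sym (negbTE n32).
    rewrite [p4 e == _]eq_sym (negbTE n34) !addbF !addbT.
    by move: a b; rewrite !negbK => /eqP -> /eqP ->; case: (c _); case: (c _).
have cG : #|S| <= 4 * #|Gd|.
  apply: leq_trans (subset_leq_card sub) _.
  have i1 := leq_imset_card (flip (p1 e)) (mem Gd).
  have i3 := leq_imset_card (flip (p3 e)) (mem Gd).
  have i13 := leq_imset_card (flip (p1 e) \o flip (p3 e)) (mem Gd).
  apply: leq_trans (leq_card_setU _ _) _; rewrite (_ : 4 = 3 + 1) // mulnDl mul1n leq_add //.
  apply: leq_trans (leq_card_setU _ _) _; rewrite (_ : 3 = 2 + 1) // mulnDl mul1n leq_add //.
  apply: leq_trans (leq_card_setU _ _) _; rewrite mul2n -addnn leq_add //.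
have -> : no_split (e |: E) = S :\: Gd.
  apply/setP => c; rewrite in_setD [c \in Gd]inE [c \in S]inE inE.
  apply/forall_inP/andP => [h|[h1 h2 e']].
    have h' : [forall e' in E, ~~ split_pairs c e'].
      by apply/forall_inP => e' e'E; apply: h; rewrite inE e'E orbT.
    by rewrite h' /= h ?inE ?eqxx.
  rewrite in_setU1 => /orP[/eqP ->|e'E]; last by move/forall_inP: h2; apply.
  by move: h1; rewrite h2.
have GS : Gd \subset S by apply/subsetP => c; rewrite inE => /andP[].
have := cardsD S Gd; rewrite (setIidPr GS); have := subset_leq_card GS; lia.
Qed.

(** Greedy choice: each round takes one element of [E], discards the at most [K] elements it
    touches, and gains a factor 3/4. *)
Lemma card_no_split E K k :
  (forall e, e \in E -> [/\ p1 e != p2 e, p3 e != p4 e, p1 e != p3 e, p1 e != p4 e & p3 e != p2 e]) ->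
  (forall e, e \in E -> #|[set e' in E | touches e e']| <= K) ->
  K * k <= #|E| -> 0 < K ->
  4 ^ k * #|no_split E| <= 3 ^ k * 2 ^ #|P|.
Proof.
move=> + + + K0; elim: k E => [|k IH] E hp hK hE.
  by rewrite !expn0 !mul1n; apply: leq_trans (max_card _) _; rewrite card_ffun card_bool.
have : 0 < #|E| by apply: leq_trans hE; rewrite muln_gt0 K0.
case/card_gt0P => e eE; pose E' := [set e' in E | ~~ touches e e'].
have E'E : E' \subset E by apply/subsetP => e'; rewrite inE => /andP[].
have IH' : 4 ^ k * #|no_split E'| <= 3 ^ k * 2 ^ #|P|.
  apply: IH => [e' /(subsetP E'E)/hp //|e' e'E'|].
    apply: leq_trans (hK e' (subsetP E'E _ e'E')).
    by apply/subset_leq_card/subsetP => x; rewrite !inE => /andP[/andP[-> _] ->].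
  have := hK e eE; have := cardsID [set e' | touches e e'] E.
  have -> : E :\: [set e' | touches e e'] = E' by apply/setP => x; rewrite !inE andbC.
  have -> : E :&: [set e' | touches e e'] = [set e' in E | touches e e'].
    by apply/setP => x; rewrite !inE.
  by move: hE; rewrite mulnS; lia.
have [n12 n34 n13 n14 n32] := hp e eE.
have step : 4 * #|no_split (e |: E')| <= 3 * #|no_split E'|.
  by apply: card_no_split_cons => // e'; rewrite inE => /andP[].
have mono : #|no_split E| <= #|no_split (e |: E')|.
  apply/subset_leq_card/subsetP => c; rewrite !inE => /forall_inP h.
  apply/forall_inP => e'; rewrite in_setU1 => /orP[/eqP ->|/(subsetP E'E)]; exact: h.
rewrite !expnS; move: (4 ^ k) (3 ^ k) (2 ^ _) IH' => a b w IH'.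
have := leq_mul (leqnn (4 * a)) mono; nia.
Qed.

End Bits.

Section SplitLines.
Variables (X : finType) (G : rel X).
Hypotheses (Gsym : symmetric G) (Grefl : reflexive G).

Let line := line G.

Hypothesis line_third : forall x y z, x != y -> x != z -> G x y -> G x z -> G z y ->
  line x z = line x y.

Lemma line_sym x y : line x y = line y x.
Proof. by apply/setP => z; rewrite !inE (Gsym x z) (Gsym z y) andbC. Qed.

Lemma mem_line1 x y : G x y -> x \in line x y.
Proof. by rewrite inE Grefl. Qed.

Lemma mem_line2 x y : G x y -> y \in line x y.
Proof. by move=> h; rewrite inE h Grefl. Qed.

Variables (V : finType) (f : V -> X).
Let L u v := line (f u) (f v).

(** The bit [c (u, l)] tells in which part of the line [l] the vertex [u] lies; an edge survives if
    its ends lie in different parts of their line. Bits are indexed by vertices and not by points,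
    so vertices with the same image have separate bits. *)
Definition split_graph (c : {ffun V * {set X} -> bool}) : rel V := fun u v =>
  [&& f u != f v, G (f u) (f v) & c (u, L u v) != c (v, L u v)].

Lemma split_graph_sym c : symmetric (split_graph c).
Proof.
by move=> u v; rewrite /split_graph /L line_sym Gsym eq_sym [c _ == _]eq_sym.
Qed.

Lemma split_graph_irrefl c : irreflexive (split_graph c).
Proof. by move=> u; rewrite /split_graph eqxx. Qed.

(* The three points of a triangle are collinear, and three bits cannot be
   pairwise different. *)
Lemma split_graph_triangle_free c u v w :
  split_graph c u v -> split_graph c v w -> split_graph c u w -> False.
Proof.
case/and3P => uv Guv cuv /and3P[vw Gvw cvw] /and3P[uw Guw cuw].
have e1 : L u w = L u v by apply: line_third => //; rewrite Gsym.
have e2 : L v w = L u v.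
  by rewrite [RHS]line_sym; apply: line_third; rewrite ?(Gsym _ (f u)) // eq_sym.
by move: cuv cvw cuw; rewrite e1 e2; do 3 case: (c _).
Qed.

(** Union bound over all matchings with [6 mu] pairs. For each of them, the probability that no
    common edge survives on both sides is at most [(3/4)^k]. *)
Lemma exists_split (v0 : V) mu d k :
  (forall x y, x != y -> G x y -> #|[set v | f v \in line x y]| < 12) ->
  (forall (B : {set V}) (phi : V -> V), #|B| = 6 * mu -> {in B &, injective phi} ->
    (forall i, i \in B -> phi i \notin B) -> mu * d <= 4 * #|common_edges G f B phi|) ->
  176 * k <= mu * d -> 2 ^ #|V| * #|V| ^ (6 * mu) * 3 ^ k < 4 ^ k ->
  exists c, forall (B : {set V}) (phi : V -> V), #|B| = 6 * mu -> {in B &, injective phi} ->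
    (forall i, i \in B -> phi i \notin B) ->
    exists i j, [/\ i \in B, j \in B, split_graph c i j & split_graph c (phi i) (phi j)].
Proof.
move=> few_on_line many hk num.
pose P := (V * {set X})%type.
pose p1 (e : V * V) : P := (e.1, L e.1 e.2).
pose p2 (e : V * V) : P := (e.2, L e.1 e.2).
pose p3 (phi : V -> V) (e : V * V) : P := (phi e.1, L (phi e.1) (phi e.2)).
pose p4 (phi : V -> V) (e : V * V) : P := (phi e.2, L (phi e.1) (phi e.2)).
pose valid (p : {set V} * {ffun V -> V}) :=
  [forall i in p.1, forall j in p.1, (p.2 i == p.2 j) ==> (i == j)] &&
  [forall i in p.1, p.2 i \notin p.1].
pose bad (p : {set V} * {ffun V -> V}) :=
  if valid p then no_split p1 p2 (p3 p.2) (p4 p.2) (common_edges G f p.1 p.2) else set0.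
have bad_small p : p \in partial_maps v0 (6 * mu) -> #|bad p| * 4 ^ k <= 3 ^ k * 2 ^ #|{: P}|.
  case: p => B phi; rewrite inE /= => /andP[/eqP cB _]; rewrite /bad.
  case: ifP => [/andP[/forall_inP i1 /forall_inP pB]|_]; last by rewrite cards0.
  have pinj : {in B &, injective phi}.
    move=> i j iB jB /eqP e; have /forall_inP /(_ j jB) /implyP /(_ e) /eqP := i1 i iB.
    by [].
  (* If [(i, j)] touches an edge, then [i] is an end of it, and the other end lies on the line of
     [(i, j)] or has its partner on the line of the partners. With at most 11 vertices per line, two
     sides and two orientations this gives 44, and [176 = 4 * 44]. *)
  rewrite mulnC /=; apply: (@card_no_split _ _ p1 p2 (p3 phi) (p4 phi) _ 44) => //.
  - move=> [i j]; rewrite !inE /= => /and3P[iB jB /and4P[ji pji Gij Gpij]].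
    have ij : (i == j) = false by apply: contraNF ji => /eqP ->.
    have pij : (phi i == phi j) = false by apply: contraNF pji => /eqP ->.
    have n v w : v \in B -> w \in B -> (v == phi w) = false.
      by move=> vB wB; apply: contraNF (pB w wB) => /eqP <-.
    have n' v w : v \in B -> w \in B -> (phi v == w) = false.
      by move=> vB wB; rewrite eq_sym n.
    by rewrite /p1 /p2 /p3 /p4 !xpair_eqE /= ij pij (n i i) // (n i j) // n'.
  - move=> [i j]; rewrite !inE /= => /and3P[iB jB /and4P[ji pji Gij Gpij]].
    pose W1 := [set v | f v \in L i j].
    pose W2 := [set v in B | f (phi v) \in L (phi i) (phi j)].
    have c1 : #|W1| <= 11 by rewrite -ltnS few_on_line // eq_sym.
    have c2 : #|W2| <= 11.
      have h : #|[set v | f v \in L (phi i) (phi j)]| <= 11.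
        by rewrite -ltnS few_on_line // eq_sym.
      apply: leq_trans h; rewrite -(card_in_imset (f := phi)).
        by apply/subset_leq_card/subsetP => y /imsetP[v]; rewrite /W2 in_set => /andP[_ h1] -> {y}; rewrite inE.
      by move=> v w; rewrite /W2 !in_set => /andP[vB _] /andP[wB _]; apply: pinj.
    have sub : [set e' in common_edges G f B phi | touches p1 p2 (p3 phi) (p4 phi) (i, j) e'] \subset
        setX [set i] W1 :|: setX W1 [set i] :|: setX [set i] W2 :|: setX W2 [set i].
      apply/subsetP => -[i' j']; rewrite inE => /andP[].
      rewrite inE /= => /and3P[iB' jB']; rewrite inE /= => /and4P[_ _ G1 G2].
      have n v w : v \in B -> w \in B -> (v == phi w) = false.
        by move=> vB wB; apply: contraNF (pB w wB) => /eqP <-.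
      have n' v w : v \in B -> w \in B -> (phi v == w) = false.
        by move=> vB wB; rewrite eq_sym n.
      rewrite /touches /p1 /p2 /p3 /p4 !xpair_eqE /= (n i i') // (n i j') // (n' i i') // (n' i j') //=.
      have mW1 v : (v \in W1) = (f v \in L i j) by rewrite in_set.
      have mW2 v : (v \in W2) = (v \in B) && (f (phi v) \in L (phi i) (phi j)) by rewrite in_set.
      rewrite !in_setU !in_setX /= !in_set1 !mW1 !mW2 iB' jB' /=.
      case/or4P => /andP[/eqP e /eqP eL].
      + by rewrite eL -e eqxx /L mem_line2 ?orbT // e.
      + by rewrite eL -e eqxx /L mem_line1 ?orbT // e.
      + have ei := pinj _ _ iB iB' e.
        by rewrite eL -ei eqxx /L mem_line2 ?orbT // ei.
      + have ei := pinj _ _ iB jB' e.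
        by rewrite eL -ei eqxx /L (@mem_line1 (f (phi i'))) ?orbT // ei.
    apply: leq_trans (subset_leq_card sub) _; rewrite (_ : 44 = 11 + 11 + 11 + 11) //.
    apply: leq_trans (leq_card_setU _ _) _; apply: leq_add; last by rewrite cardsX cards1 ?mul1n ?muln1.
    apply: leq_trans (leq_card_setU _ _) _; apply: leq_add; last by rewrite cardsX cards1 ?mul1n ?muln1.
    apply: leq_trans (leq_card_setU _ _) _; apply: leq_add; last by rewrite cardsX cards1 ?mul1n ?muln1.
    by rewrite cardsX cards1 mul1n.
  - rewrite -(@leq_pmul2l 4) // mulnA; apply: leq_trans hk (many B phi cB pinj _).
    by move=> i /pB.
have : 0 < #|~: \bigcup_(p in partial_maps v0 (6 * mu)) bad p|.
  have := card_union bad_small; have := card_partial_maps v0 (6 * mu).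
  set S := \bigcup_(p in _) _ => h1 h2.
  have h3 : #|S| * 4 ^ k < 2 ^ #|{: P}| * 4 ^ k.
    apply: (leq_ltn_trans h2); rewrite mulnA mulnC ltn_pmul2l ?expn_gt0 //.
    by apply: leq_ltn_trans num; rewrite leq_mul2r h1 orbT.
  move: h3; rewrite ltn_pmul2r ?expn_gt0 // => h3.
  by rewrite -(ltn_add2l #|S|) addn0 cardsC card_ffun card_bool.
case/card_gt0P => c; rewrite inE => hc; exists c => B phi cB pinj pB.
(* The representative of [phi] on [B] among the partial maps. *)
pose psi := [ffun v => if v \in B then phi v else v0].
have psiE i : i \in B -> psi i = phi i by rewrite ffunE => ->.
have vp : valid (B, psi).
  apply/andP; split; last first.
    by apply/forall_inP => i iB; rewrite psiE // pB.
  apply/forall_inP => i iB; apply/forall_inP => j jB; rewrite !psiE //.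
  by apply/implyP => /eqP /pinj -> //.
have : c \notin bad (B, psi).
  apply: contra hc => hc; apply/bigcupP; exists (B, psi) => //.
  by rewrite -cB restrict_partial_map.
rewrite /bad vp inE negb_forall_in => /exists_inP[[i j]].
rewrite !inE /= => /and3P[iB jB /and4P[ji pji Gij Gpij]].
rewrite negbK => /andP[s1 s2]; exists i, j; split=> //.
  by rewrite /split_graph eq_sym ji Gij.
by move: pji Gpij s2; rewrite /split_graph /p3 /p4 /= !psiE // eq_sym => -> ->.
Qed.

End SplitLines.

(** * The affine polar graph *)

Section LightCone.
Local Open Scope ring_scope.
Variable F : finFieldType.
Hypothesis sqN1 : forall x : F, x ^+ 2 != -1.
Let q := #|F|.

Lemma two_neq0 : (2%:R : F) != 0.
Proof.
apply: contra (sqN1 1) => /eqP h2; rewrite expr1n -subr_eq0 opprK.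
by rewrite -[1 + 1]/(2%:R) h2.
Qed.

(** As [-1] is not a square, the binary form [c^2 + d^2] is anisotropic. *)
Lemma sum_squares_eq0 (c d : F) : (c ^+ 2 + d ^+ 2 == 0) = (c == 0) && (d == 0).
Proof.
apply/idP/idP; last by case/andP=> /eqP -> /eqP ->; rewrite expr0n addr0.
move=> h; have [d0|d0] := eqVneq d 0.
  by move: h; rewrite d0 expr0n /= addr0 sqrf_eq0 => ->.
case/negP: (sqN1 (c / d)); rewrite expr_div_n; apply/eqP.
have -> : c ^+ 2 = - d ^+ 2 by apply/eqP; rewrite -addr_eq0.
by rewrite mulNr divff // sqrf_eq0.
Qed.

Definition circle (r : F) := [set p : F * F | p.1 ^+ 2 + p.2 ^+ 2 == r].

Lemma circle0 : #|circle 0| = 1%N.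
Proof.
rewrite -(cards1 (0 : F * F)); apply: eq_card => -[c d]; rewrite !inE /=.
by rewrite sum_squares_eq0 xpair_eqE.
Qed.

(** A nonzero square has at most two roots and zero has one, so [q <= 2 * #|S| - 1]. *)
Lemma card_squares : (q < 2 * #|[set x ^+ 2 | x : F]|)%N.
Proof.
rewrite mul2n -addnn; set S := [set _ | _ in _].
have S0 : (0 : F) \in S by apply/imsetP; exists 0; rewrite // expr0n.
have: (#|[set: F]| <= #|S| + #|S :\ 0%R|)%N.
  have hS (y : F) : (#|[set x : F | x ^+ 2 == y]| <= (y \in S) + (y \in S :\ 0%R))%N.
    rewrite in_setD1; have [/imsetP[x _ ->]|yS] := boolP (y \in S); last first.
      rewrite andbF leqn0 cards_eq0; apply/eqP/setP => x; rewrite !inE.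
      apply/negP => /eqP h; case/negP: yS; apply/imsetP; exists x => //.
    rewrite sqrf_eq0 /= andbT; have [->|x0] := eqVneq x 0.
      rewrite expr0n /= addn0 -[X in (_ <= X)%N](cards1 (0:F)) subset_leq_card //.
      by apply/subsetP => z; rewrite !inE sqrf_eq0.
    apply: (@leq_trans #|[set x; - x]|); last by rewrite cards2; case: (_ != _).
    by apply/subset_leq_card/subsetP => z; rewrite !inE eqf_sqr.
  have -> : #|[set: F]| = (\sum_(y : F) #|[set x : F | x ^+ 2 == y]|)%N.
    rewrite -sum1_card (partition_big (fun x : F => x ^+ 2) predT) //=.
    apply: eq_bigr => y _; rewrite -sum1_card; apply: eq_bigl => x.
    by rewrite !inE.
  apply: (leq_trans (leq_sum _ (fun y _ => hS y))).
  rewrite big_split /= -!big_mkcond /=.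
  by rewrite !sum1_card.
rewrite cardsT -/q => h; apply: (leq_ltn_trans h).
by rewrite ltn_add2l [X in (_ < X)%N](cardsD1 0 S) S0.
Qed.

(** Pigeonhole: the squares and their reflections [r - y] each fill more than half of the field. *)
Lemma circle_neq0 r : circle r != set0.
Proof.
pose S := [set x ^+ 2 | x : F]; pose S' := [set r - y | y in S].
have cS' : #|S'| = #|S| by apply: card_imset => x y /addrI /oppr_inj.
have : S :&: S' != set0.
  apply/negP => /eqP h; have := cardsU S S'.
  have := max_card (S :|: S'); have := card_squares; rewrite -/S -/q.
  by rewrite h cards0 cS'; lia.
case/set0Pn => y; rewrite inE => /andP[/imsetP[c _ ->]] /imsetP[_ /imsetP[d _ ->] h].
by apply/set0Pn; exists (c, d); rewrite inE /= h subrK.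
Qed.

Lemma card_circle_le r s : r != 0 -> s != 0 -> (#|circle r| <= #|circle s|)%N.
Proof.
move=> r0 s0; have /set0Pn[[c0 d0]] := circle_neq0 (s / r); rewrite inE /= => /eqP h0.
(* Multiplication by an element of norm [s / r] in the quadratic extension obtained by adjoining a
   root of [-1]. *)
pose m (p : F * F) := (p.1 * c0 - p.2 * d0, p.1 * d0 + p.2 * c0).
have hm p : (m p).1 ^+ 2 + (m p).2 ^+ 2 = (p.1 ^+ 2 + p.2 ^+ 2) * (s / r).
  by rewrite -h0 /m /=; ring.
have mB p p' : m (p - p') = m p - m p'.
  by case: p p' => [a b] [a' b']; rewrite /m /=; congr pair => /=; ring.
have minj : injective m.
  move=> p p' e; apply/eqP; rewrite -subr_eq0.
  have := hm (p - p'); rewrite mB e subrr /= expr0n addr0 => /esym/eqP.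
  rewrite !mulf_eq0 invr_eq0 (negbTE r0) (negbTE s0) !orbF sum_squares_eq0.
  by [].
rewrite -(card_imset _ minj) subset_leq_card //; apply/subsetP => _ /imsetP[p hp ->].
move: hp; rewrite !inE hm => /eqP ->.
by apply/eqP; field.
Qed.

(** All circles of nonzero radius have the same size, and with the single point of radius zero they
    partition the [q^2] points of the plane. *)
Lemma card_circle r : r != 0 -> #|circle r| = q.+1.
Proof.
move=> r0.
have e s : s != 0 -> #|circle s| = #|circle r|.
  by move=> s0; apply/eqP; rewrite eqn_leq !card_circle_le.
have : #|{: F * F}| = (\sum_(s : F) #|circle s|)%N.
  rewrite -sum1_card (partition_big (fun p : F * F => p.1 ^+ 2 + p.2 ^+ 2) predT) //=.
  by apply: eq_bigr => s _; rewrite -sum1_card; apply: eq_bigl => x; rewrite !inE.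
rewrite (bigD1 0) //= circle0 (eq_bigr (fun=> #|circle r|)) //.
rewrite sum_nat_const card_prod -/q.
have -> : #|[pred i : F | i != 0]| = q.-1.
  by have := cardC1 (0 : F) => <-; apply: eq_card => x; rewrite !inE.
have q1 : (1 < q)%N by apply: finNzRing_gt1.
move=> h; have {h} : (q.-1 * #|circle r| = q.-1 * q.+1)%N.
  by case: (q) q1 h => // k; lia.
by move/eqP; rewrite eqn_pmul2l ?(eqP _) //; [move/eqP | lia].
Qed.

Definition point := ((F * F) * (F * F))%type.
(** A hyperbolic plane plus an anisotropic plane: the elliptic form in dimension four. *)
Definition qform (w : point) := w.1.1 * w.1.2 - w.2.1 ^+ 2 - w.2.2 ^+ 2.
Definition lightlike (x y : point) := qform (x - y) == 0.

Definition codeg (w : point) := #|[set u | (qform u == 0) && (qform (w - u) == 0)]|.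

Lemma qformN w : qform (- w) = qform w.
Proof. by rewrite /qform /=; ring. Qed.

Lemma qform_mul (l : F) w : qform ((l * w.1.1, l * w.1.2), (l * w.2.1, l * w.2.2)) = l ^+ 2 * qform w.
Proof. by rewrite /qform /=; ring. Qed.

Lemma codeg_isometry (T : point -> point) w : injective T ->
  (forall u v, T (u - v) = T u - T v) -> (forall u, qform (T u) = qform u) ->
  codeg (T w) = codeg w.
Proof.
move=> Tinj TB TQ; rewrite /codeg -[RHS](card_imset _ Tinj).
apply: eq_card => v; rewrite inE; apply/idP/imsetP.
  move=> h; exists (invF Tinj v); last by rewrite f_invF.
  by rewrite inE -TQ -[qform (w - _)]TQ TB f_invF.
by case=> u; rewrite inE => h ->; rewrite -TB !TQ.
Qed.


Lemma card_eq_can (A B : finType) (S1 : {set A}) (S2 : {set B}) (f : A -> B) (g : B -> A) :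
  {in S1, forall u, f u \in S2} -> {in S2, forall p, g p \in S1} ->
  {in S1, cancel f g} -> {in S2, cancel g f} -> #|S1| = #|S2|.
Proof.
move=> h1 h2 K1 K2; apply/eqP; rewrite eqn_leq; apply/andP; split.
  rewrite -(card_in_imset (can_in_inj K1)) subset_leq_card //.
  by apply/subsetP => _ /imsetP[u hu ->]; apply: h1.
rewrite -(card_in_imset (can_in_inj K2)) subset_leq_card //.
by apply/subsetP => _ /imsetP[u hu ->]; apply: h2.
Qed.

Lemma card_fibers (A B : finType) (P : A -> {set B}) :
  #|[set p : A * B | p.2 \in P p.1]| = (\sum_a #|P a|)%N.
Proof.
rewrite -sum1_card (eq_bigr (fun a => \sum_(b in P a) 1)%N); last first.
  by move=> a _; rewrite sum1_card.
by rewrite pair_big_dep /=; apply: eq_bigl => p; rewrite inE.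
Qed.

(** On the cone, [qform (w - u) = 0] is a linear equation in [u], which determines [u.1.2] because
    [w.1.1] is nonzero. After the change of variables [f], the remaining equation says that a point
    lies on a circle. *)
Lemma codeg_fibers (w : point) : w.1.1 != 0 ->
  codeg w = (\sum_a #|circle (a * (w.1.1 - a) * qform w)%R|)%N.
Proof.
case: w => [[a0 b0] [c0 d0]] /=; set w := (_, _) => a0n0.
rewrite -card_fibers /codeg.
pose f (u : point) := (u.1.1, (a0 * u.2.1 - u.1.1 * c0, a0 * u.2.2 - u.1.1 * d0)).
pose gc (p : F * (F * F)) := (p.2.1 + p.1 * c0) / a0.
pose gd (p : F * (F * F)) := (p.2.2 + p.1 * d0) / a0.
(* The polar bilinear form of [qform] at [w] and [u]. *)
pose lin (u : point) := a0 * u.1.2 + u.1.1 * b0 - 2%:R * (u.2.1 * c0 + u.2.2 * d0).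
pose gb p := (qform w - p.1 * b0 + 2%:R * (gc p * c0 + gd p * d0)) / a0.
pose g p : point := ((p.1, gb p), (gc p, gd p)).
have linE u : qform (w - u) = qform w + qform u - lin u.
  by rewrite /qform /lin /w /=; ring.
have fE u : (f u).2.1 ^+ 2 + (f u).2.2 ^+ 2 - (f u).1 * (a0 - (f u).1) * qform w
  = - a0 ^+ 2 * qform u + a0 * u.1.1 * (qform u - qform (w - u)).
  by rewrite linE /lin /f /qform /w /=; ring.
apply: (card_eq_can (f := f) (g := g)).
- move=> u; rewrite !inE => /andP[/eqP e1 /eqP e2].
  by rewrite -subr_eq0 fE e1 e2; apply/eqP; ring.
- move=> p; rewrite !inE => /eqP h.
  have fg : f (g p) = p.
    by case: p {h} => a [c d]; rewrite /f /g /gc /gd /=; congr (_, (_, _)); field.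
  have lg : lin (g p) = qform w by rewrite /lin /g /gb /=; field.
  have e : qform (w - g p) = qform (g p) by rewrite linE lg addrAC subrr add0r.
  have := fE (g p); rewrite fg h subrr e subrr mulr0 addr0 => /esym/eqP.
  by rewrite mulf_eq0 oppr_eq0 sqrf_eq0 (negbTE a0n0) /= => ->.
- case=> [[a b] [c d]]; rewrite !inE => /andP[/eqP e1 /eqP e2].
  have ec : gc (f ((a, b), (c, d))) = c by rewrite /gc /f /=; field.
  have ed : gd (f ((a, b), (c, d))) = d by rewrite /gd /f /=; field.
  rewrite /g /gb ec ed; congr ((_, _), (_, _)).
  move: e2; rewrite linE e1 addr0 => /eqP; rewrite subr_eq0 => /eqP ->.
  by rewrite /lin /f /=; field.
- case=> a [c d] _.
  by rewrite /f /g /gc /gd /=; congr (_, (_, _)); field.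
Qed.

Lemma qform0 : qform 0 = 0.
Proof. by rewrite /qform /=; ring. Qed.

(** The count is [(2 q - 1) + (q - 1)^2 (q + 1)]: one point over each of the [2 q - 1] pairs with
    product zero and a circle of [q + 1] points over the others. *)
Lemma card_cone : codeg 0 = (q ^ 3 - q ^ 2 + q)%N.
Proof.
have -> : codeg 0 = #|[set p : (F * F) * (F * F) | p.2 \in circle (p.1.1 * p.1.2)]|.
  rewrite /codeg; apply: eq_card => u; rewrite !inE sub0r qformN andbb.
  rewrite /qform -addrA -opprD subr_eq0 eq_sym //.
rewrite (card_fibers (fun p : F * F => circle (p.1 * p.2))).
rewrite (eq_bigr (fun p : F * F => (if p.1 == 0%R then 1 else if p.2 == 0%R then 1 else q.+1)%N)); last first.
  move=> p _; have [->|p1] := eqVneq p.1 0; first by rewrite mul0r circle0.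
  have [->|p2] := eqVneq p.2 0; first by rewrite mulr0 circle0.
  by rewrite card_circle // mulf_neq0.
rewrite -(pair_big predT predT (fun a b : F => if a == 0%R then 1 else if b == 0%R then 1 else q.+1)%N) /=.
have cN : #|[pred i : F | i != 0]| = q.-1.
  by have := cardC1 (0 : F) => <-; apply: eq_card => x; rewrite !inE.
rewrite (bigD1 0) //= eqxx sum1_card.
rewrite (eq_bigr (fun=> 1 + q.-1 * q.+1)%N); last first.
  move=> a /negbTE ->; rewrite (bigD1 0) //= eqxx.
  rewrite (eq_bigr (fun=> q.+1)); last by move=> b /negbTE ->.
  by rewrite sum_nat_const cN.
rewrite sum_nat_const cN cardT -cardE -/q.
have : (1 < q)%N by apply: finNzRing_gt1.
by case: (q) => // k _; nia.
Qed.

Definition codegree_value (w : point) : nat :=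
  if w == 0 then (q ^ 3 - q ^ 2 + q)%N else if qform w == 0 then q else (q ^ 2 - q)%N.

(** If [qform w = 0], all [q] circles are single points. Otherwise two of them are, and the total is
    [2 + (q - 2) (q + 1)]. *)
Lemma codeg_lead w : w.1.1 != 0 -> codeg w = codegree_value w.
Proof.
move=> w0; rewrite codeg_fibers // /codegree_value.
have -> : (w == 0) = false by apply/negP => /eqP e; rewrite e eqxx in w0.
have [->|Q0] := eqVneq (qform w) 0.
  rewrite (eq_bigr (fun=> 1%N)); last by move=> a _; rewrite mulr0 circle0.
  by rewrite sum1_card.
rewrite (bigD1 0) //= !mul0r circle0 (bigD1 w.1.1) //= subrr mulr0 mul0r circle0.
rewrite (eq_bigr (fun=> q.+1)); last first.
  move=> a /andP[a0 aw]; rewrite card_circle // !mulf_neq0 //.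
  by rewrite subr_eq0 eq_sym.
rewrite sum_nat_const.
have -> : #|[pred i : F | (i != 0) && (i != w.1.1)]| = q.-2.
  have := cardC (pred2 0 w.1.1); rewrite card2 eq_sym w0 -/q => h.
  have -> : q.-2 = #|[predC pred2 0 w.1.1]| by rewrite -h.
  by apply: eq_card => x; rewrite !inE negb_or.
have : (1 < q)%N by apply: finNzRing_gt1.
by case: (q) => [|[|k]] // _; nia.
Qed.

(** An isometry moves every nonzero [w] to a vector with nonzero first coordinate. *)
Lemma codegE w : codeg w = codegree_value w.
Proof.
have shift (T : point -> point) : injective T ->
  (forall u v, T (u - v) = T u - T v) -> (forall u, qform (T u) = qform u) ->
  (T w).1.1 != 0 -> codeg w = codegree_value w.
  move=> Ti TB TQ h; rewrite -(codeg_isometry _ Ti TB TQ) codeg_lead //.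
  rewrite /codegree_value TQ; congr (if _ then _ else _).
  have T0 : T 0 = 0 by have := TB 0 0; rewrite !subrr.
  by apply/eqP/eqP => [e|->//]; apply: Ti; rewrite T0.
have [a0|] := eqVneq w.1.1 0; last exact: codeg_lead.
have [b0|b0] := eqVneq w.1.2 0; last first.
  apply: (shift (fun u => ((u.1.2, u.1.1), u.2))) => //.
  - by move=> [[a b] z] [[a' b'] z'] /= [-> -> ->].
  - by move=> u; rewrite /qform /=; ring.
have [c0|c0] := eqVneq w.2.1 0; last first.
  (* An Eichler transformation; it gives [w] the first coordinate [2 * w.2.1], nonzero in odd
     characteristic. *)
  apply: (shift (fun u => ((u.1.1 + 2%:R * u.2.1 + u.1.2, u.1.2), (u.2.1 + u.1.2, u.2.2)))) => //.
  - move=> [[a b] [c d]] [[a' b'] [c' d']] /= [e1 e2 e3 ->].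
    move: e1 e3; rewrite e2 => e1 /addIr e3; move: e1; rewrite e3 => e1; have -> // : a = a'.
    by apply: (@addIr _ (2%:R * c' + b')); rewrite !addrA.
  - by move=> u v /=; congr ((_, _), (_, _)) => /=; ring.
  - by move=> u; rewrite /qform /=; ring.
  - by rewrite /= a0 b0 add0r addr0 mulf_neq0 // two_neq0.
have [d0|d0] := eqVneq w.2.2 0; last first.
  apply: (shift (fun u => ((u.1.1 + 2%:R * u.2.2 + u.1.2, u.1.2), (u.2.1, u.2.2 + u.1.2)))) => //.
  - move=> [[a b] [c d]] [[a' b'] [c' d']] /= [e1 e2 -> e3].
    move: e1 e3; rewrite e2 => e1 /addIr e3; move: e1; rewrite e3 => e1; have -> // : a = a'.
    by apply: (@addIr _ (2%:R * d' + b')); rewrite !addrA.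
  - by move=> u v /=; congr ((_, _), (_, _)) => /=; ring.
  - by move=> u; rewrite /qform /=; ring.
  - by rewrite /= a0 b0 add0r addr0 mulf_neq0 // two_neq0.
have -> : w = 0.
  by case: w a0 b0 c0 d0 {shift} => [[a b] [c d]] /= -> -> -> ->.
by rewrite card_cone /codegree_value eqxx.
Qed.

Lemma card_common (x y : point) :
  #|[set z | lightlike x z && lightlike z y]| = codegree_value (x - y).
Proof.
rewrite -codegE /codeg; pose f z : point := x - z.
apply: (card_eq_can (f := f) (g := f)) => z; rewrite !inE /lightlike /f.
- by rewrite opprB (addrC (x - y)) subrKA.
- rewrite subKr.
  have -> : x - z - y = (x - y) - z by rewrite addrAC.
  by [].
- by rewrite subKr.
- by rewrite subKr.
Qed.

Lemma lightlike_sym : symmetric lightlike.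
Proof. by move=> x y; rewrite /lightlike -qformN opprB. Qed.

Lemma lightlike_refl : reflexive lightlike.
Proof. by move=> x; rewrite /lightlike subrr qform0. Qed.

Let line := line lightlike.

Definition scale (l : F) (w : point) : point :=
  ((l * w.1.1, l * w.1.2), (l * w.2.1, l * w.2.2)).

(** The direction is isotropic, so all points of the affine line are common neighbours; both sets
    have [q] elements. *)
Lemma line_param x y : x != y -> lightlike x y ->
  line x y = [set x + scale l (y - x) | l : F].
Proof.
move=> xy Gxy; have Q0 : qform (y - x) = 0 by apply/eqP; rewrite -qformN opprB.
have xy0 : x - y != 0 by rewrite subr_eq0.
have yx0 : y - x != 0 by rewrite subr_eq0 eq_sym.
apply/esym/eqP; rewrite eqEcard; apply/andP; split.
  apply/subsetP => _ /imsetP[l _ ->]; rewrite inE /lightlike.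
  rewrite opprD addNKr qformN qform_mul Q0 mulr0 eqxx /=.
  have -> : x + scale l (y - x) - y = scale (l - 1) (y - x).
    by rewrite /scale /=; case: x y {xy Gxy Q0 xy0 yx0} => [[? ?] [? ?]] [[? ?] [? ?]] /=;
      congr ((_, _), (_, _)) => /=; ring.
  by rewrite qform_mul Q0 mulr0.
rewrite card_common /codegree_value (negbTE xy0) -qformN opprB Q0 eqxx.
rewrite card_imset // => l l' /addrI.
move: yx0; case: (y - x) => [[a b] [c d]] yx0 [ea eb ec ed]; apply/eqP.
apply: contraNT yx0 => ll'; have h (t : F) : l * t = l' * t -> t = 0.
  by move=> e; apply/eqP; rewrite -(mulrI_eq0 _ (lregP (x := l - l') _)) ?subr_eq0 // mulrBl e subrr.
by rewrite (h _ ea) (h _ eb) (h _ ec) (h _ ed).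
Qed.

Lemma line_third x y z : x != y -> x != z -> lightlike x y -> lightlike x z ->
  lightlike z y -> line x z = line x y.
Proof.
move=> xy xz Gxy Gxz Gzy; have : z \in line x y by rewrite inE Gxz.
rewrite (line_param xz Gxz) (line_param xy Gxy) => /imsetP[l _ zE].
apply/eqP; rewrite eqEcard; apply/andP; split.
  apply/subsetP => _ /imsetP[m _ ->]; apply/imsetP; exists (m * l) => //.
  by rewrite zE addrAC subrr add0r /scale /= !mulrA.
rewrite -(line_param xz Gxz) -(line_param xy Gxy) !card_common /codegree_value.
have n0 u : x != u -> (x - u == 0) = false by rewrite -subr_eq0 => /negbTE.
by move: Gxy Gxz; rewrite /lightlike (n0 _ xy) (n0 _ xz) => -> ->.
Qed.

Lemma card_point : #|{: point}| = (q ^ 4)%N.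
Proof. by rewrite !card_prod -/q; lia. Qed.

End LightCone.

(** * Odd minors of the complement *)

Definition complement (T : finType) (H : rel T) : rel T := fun x y => (x != y) && ~~ H x y.

Lemma complement_simple (T : finType) (H : rel T) : symmetric H -> simple_graph (complement H).
Proof.
by move=> Hs; split=> [x y|x]; rewrite /complement ?eqxx // Hs eq_sym.
Qed.

Lemma complement_alpha (T : finType) (H : rel T) : symmetric H ->
  (forall u v w, H u v -> H v w -> H u w -> False) -> alpha (complement H) <= 2.
Proof.
move=> Hs tf; apply/bigmax_leqP => A hA; rewrite leqNgt; apply/negP => cA.
have : uniq (enum A) by apply: enum_uniq.
have memA z : z \in enum A -> z \in A by rewrite mem_enum.
move: cA memA; rewrite cardE; case: (enum A) => [|u [|v [|w l]]] // _ memA /=.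
rewrite !inE !negb_or -!andbA => /and5P[uv uw _ vw _].
have H' x y : x \in A -> y \in A -> x != y -> H x y.
  move=> xA yA xy; have /forall_inP /(_ x xA) /forall_inP /(_ y yA) := hA.
  by rewrite /complement xy negbK.
by apply: (tf u v w); apply: H' => //; apply: memA; rewrite !inE eqxx ?orbT.
Qed.

Section OddMinor.
Variables (V : finType) (H : rel V) (mu : nat).
Hypotheses (Hirr : irreflexive H).
Hypothesis Hpairs : forall (B : {set V}) (phi : V -> V), #|B| = 6 * mu ->
  {in B &, injective phi} -> (forall i, i \in B -> phi i \notin B) ->
  exists i j, [/\ i \in B, j \in B, H i j & H (phi i) (phi j)].

(** A stable set with [12 mu] vertices would contain a matching between two disjoint [6 mu]-subsets,
    and [Hpairs] would give an edge inside it. *)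
Lemma stable_lt (W : {set V}) : (forall x y, x \in W -> y \in W -> ~~ H x y) ->
  #|W| < 12 * mu.
Proof.
move=> st; rewrite ltnNge; apply/negP => cW.
have [B BW cB] : exists2 B : {set V}, B \subset W & #|B| = 6 * mu.
  by apply: exists_subset_card; apply: leq_trans cW; rewrite leq_mul2r orbT.
have cR : 6 * mu <= #|W :\: B|.
  by have := cardsD W B; rewrite (setIidPr BW) cB; lia.
(* The vertex at the same position in the enumeration of [W :\: B]. *)
pose phi x := nth x (enum (W :\: B)) (index x (enum B)).
have idx x : x \in B -> index x (enum B) < size (enum (W :\: B)).
  move=> xB; rewrite -cardE; apply: leq_trans cR.
  by rewrite -cB [X in _ < X]cardE index_mem mem_enum.
have pB x : x \in B -> phi x \in W :\: B by move=> xB; rewrite -mem_enum mem_nth ?idx.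
have [||x [y [xB yB Hxy _]]] := Hpairs (phi := phi) cB.
- move=> x y xB yB; rewrite /phi (set_nth_default y) ?idx // => /eqP.
  by rewrite nth_uniq ?idx ?enum_uniq // => /eqP /index_inj -> //; rewrite mem_enum.
- by move=> x /pB; rewrite inE => /andP[].
by move: (st x y (subsetP BW _ xB) (subsetP BW _ yB)); rewrite Hxy.
Qed.

Variables (t : nat) (S : 'I_t -> {set V}) (F : 'I_t -> rel V) (c : 'I_t -> V -> bool).
Hypotheses (treeS : forall i, is_tree_subgraph (complement H) (S i) (F i))
  (disjS : forall i j, i != j -> [disjoint S i & S j])
  (properF : forall i x y, F i x y -> c i x != c i y)
  (meet : forall i j, i != j ->
     exists x y, [/\ x \in S i, y \in S j, complement H x y & c i x == c j y]).

Lemma tree_index_uniq i j x : x \in S i -> x \in S j -> i = j.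
Proof.
move=> xi xj; apply/eqP; apply: contraT => /disjS; rewrite disjoint_subset.
by move/subsetP /(_ x xi); rewrite inE xj.
Qed.

Lemma card_tree_gt0 i : 0 < #|S i|.
Proof. by rewrite card_gt0; case: (treeS i). Qed.

Lemma tree_ex i : exists x, x \in S i.
Proof. by apply/set0Pn; rewrite -card_gt0 card_tree_gt0. Qed.

Let vert i : V := xchoose (tree_ex i).
Let vertP i : vert i \in S i. Proof. exact: xchooseP. Qed.

(** The default [vert i] is taken when the tree has no vertex of colour [b]; trees with two vertices
    have both colours. *)
Definition colored b i : V := odflt (vert i) [pick x in S i | c i x == b].

Lemma colored_in b i : colored b i \in S i.
Proof.
rewrite /colored; case: pickP => /= [x /andP[] //|_]; exact: vertP.
Qed.

Lemma tree2_colored i b : #|S i| = 2 -> c i (colored b i) = b.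
Proof.
move=> cS; suff [x xS cx] : exists2 x, x \in S i & c i x = b.
  rewrite /colored; case: pickP => [y /andP[_ /eqP] //|/(_ x)].
  by rewrite xS cx eqxx.
have /eqP /cards2P [x [y [xy SE]]] := cS.
have xS : x \in S i by rewrite SE !inE eqxx.
have yS : y \in S i by rewrite SE !inE eqxx orbT.
have [_ sub _ conn _] := treeS i.
have /connectP[[|z p] /= + yE] := conn x y xS yS; first by move: xy; rewrite yE eqxx.
case/andP => Fxz _; have [_ _ zS] := sub x z Fxz; have := properF Fxz => cxz.
have [e|e] := eqVneq (c i x) b; first by exists x.
by exists z => //; move: e cxz; case: b; case: (c i x); case: (c i z).
Qed.

Lemma tree2_color_inj i x y : #|S i| = 2 -> x \in S i -> y \in S i -> c i x = c i y -> x = y.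
Proof.
move=> cS; have SE : [set colored true i; colored false i] = S i.
  apply/eqP; rewrite eqEcard cS cards2; apply/andP; split.
    by apply/subsetP => z; rewrite !inE => /orP[] /eqP ->; apply: colored_in.
  suff -> : colored true i != colored false i by [].
  by apply/eqP => e; have := tree2_colored true cS; rewrite e tree2_colored.
rewrite -SE !inE => /orP[] /eqP -> /orP[] /eqP -> //; by rewrite !tree2_colored.
Qed.

(** Two trees with one vertex each can meet only through these vertices, which are then adjacent in
    the complement; so such vertices are stable in [H]. *)
Lemma few_singletons b : #|[set i | (#|S i| == 1) && (c i (vert i) == b)]| < 12 * mu.
Proof.
set I := [set i | _].
have vinj : {in I &, injective vert}.
  by move=> i j _ _ e; apply: (@tree_index_uniq i j (vert i)); rewrite ?vertP // e vertP.
rewrite -(card_in_imset vinj); apply: stable_lt => _ _ /imsetP[i iI ->] /imsetP[j jI ->].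
have single k x : k \in I -> x \in S k -> x = vert k.
  rewrite inE => /andP[/cards1P[z zE] _]; have := vertP k; rewrite zE !inE.
  by move=> /eqP -> /eqP.
have [->|ij] := eqVneq i j; first by rewrite Hirr.
have [x [y [xi yj /andP[_ nH] _]]] := meet ij.
by rewrite -(single i x) // -(single j y).
Qed.

(** Match the vertex coloured [true] with the one coloured [false] in each tree. [Hpairs] yields two
    trees for which both monochromatic pairs are edges of [H], so that they cannot meet. *)
Lemma few_doubletons : #|[set i | #|S i| == 2]| < 6 * mu.
Proof.
rewrite ltnNge; apply/negP => /exists_subset_card[I /subsetP sI cI].
have I2 i : i \in I -> #|S i| = 2 by move/sI; rewrite inE => /eqP.
pose phi x := if [pick i in I | x \in S i] is Some i then colored false i else x.
have phiE i : i \in I -> phi (colored true i) = colored false i.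
  move=> iI; rewrite /phi; case: pickP => [j /andP[_ xj]|/(_ i)].
    by rewrite (tree_index_uniq xj (colored_in true i)).
  by rewrite iI colored_in.
have inj b : {in I &, injective (colored b)}.
  move=> i j _ _ e; apply: (@tree_index_uniq i j (colored b i)); rewrite ?colored_in //.
  by rewrite e colored_in.
have [|||_ [_ [/imsetP[i iI ->] /imsetP[j jI ->] H1 H2]]] :=
  Hpairs (B := colored true @: I) (phi := phi).
- by rewrite card_in_imset.
- move=> _ _ /imsetP[i iI ->] /imsetP[j jI ->]; rewrite !phiE // => /inj -> //.
- move=> _ /imsetP[i iI ->]; rewrite phiE //; apply/negP => /imsetP[j jI e].
  have ij : i = j.
    by apply: (@tree_index_uniq i j (colored false i)); rewrite ?colored_in // e colored_in.
  have := tree2_colored false (I2 i iI).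
  by rewrite e -ij (tree2_colored true (I2 i iI)).
have ij : i != j by apply: contraL H1 => /eqP ->; rewrite Hirr.
move: H2; rewrite !phiE // => H2.
have [x [y [xi yj /andP[_ nH] /eqP cxy]]] := meet ij.
case/negP: nH; case cx : (c i x).
  have -> : x = colored true i.
    by apply: (tree2_color_inj (I2 i iI)) => //; rewrite ?colored_in // tree2_colored // I2.
  have -> // : y = colored true j.
  by apply: (tree2_color_inj (I2 j jI)) => //; rewrite ?colored_in // -cxy cx tree2_colored // I2.
have -> : x = colored false i.
  by apply: (tree2_color_inj (I2 i iI)) => //; rewrite ?colored_in // tree2_colored // I2.
have -> // : y = colored false j.
by apply: (tree2_color_inj (I2 j jI)) => //; rewrite ?colored_in // -cxy cx tree2_colored // I2.
Qed.

(** Each tree size is at least 3 up to a correction of 2 for one vertex and 1 for two vertices;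
    summing gives [54 = 2 * 24 + 6]. *)
Lemma odd_minor_order : 3 * t < #|V| + 54 * mu.
Proof.
have total : \sum_i #|S i| <= #|V|.
  rewrite (eq_bigr (fun i => \sum_x (x \in S i))); last first.
    by move=> i _; rewrite -sum1_card big_mkcond.
  rewrite exchange_big /= -sum1_card; apply: leq_sum => x _.
  rewrite -big_mkcond sum1_card; apply/card_le1_eqP => i j xi xj.
  exact: (tree_index_uniq xj xi).
have cE (P : pred 'I_t) : #|[set i | P i]| = \sum_i P i.
  by rewrite -sum1_card big_mkcond; apply: eq_bigr => i _; rewrite inE; case: (P i).
have singles : \sum_i (#|S i| == 1) < 24 * mu.
  have := few_singletons true; have := few_singletons false.
  have : \sum_i (#|S i| == 1) <=
      #|[set i | (#|S i| == 1) && (c i (vert i) == false)]| +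
      #|[set i | (#|S i| == 1) && (c i (vert i) == true)]|.
    rewrite !cE -big_split /=; apply: leq_sum => i _.
    by case: (#|S i| == 1); case: (c i (vert i)).
  lia.
have doubles : \sum_i (#|S i| == 2) < 6 * mu.
  by have := few_doubletons; rewrite cE.
have : 3 * t <= \sum_i (#|S i| + ((#|S i| == 1) + (#|S i| == 1) + (#|S i| == 2))).
  rewrite -[t in 3 * t]card_ord mulnC -sum_nat_const; apply: leq_sum => i _.
  by have := card_tree_gt0 i; case: (#|S i|) => [|[|[|k]]].
rewrite !big_split /= => h; apply: leq_ltn_trans h _.
rewrite (_ : 54 * mu = 24 * mu + 24 * mu + 6 * mu); last by lia.
rewrite -addnS leq_add // -addnS leq_add //.
by rewrite leq_add // ltnW.
Qed.

End OddMinor.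

(** * Choice of the parameters *)

Lemma bernoulli m k : m ^ k * (m + k) <= m * m.+1 ^ k.
Proof.
elim: k => [|k IH]; first by rewrite !expn0 mul1n addn0 muln1.
rewrite !expnSr; move: (m ^ k) (m.+1 ^ k) IH => a b IH.
have h : a * (m + k) * m.+1 <= m * b * m.+1 by rewrite leq_mul2r IH orbT.
rewrite mulnA; apply: leq_trans h.
by rewrite -!mulnA leq_mul2l; apply/orP; right; nia.
Qed.

(** Bernoulli's inequality in the form [(1 + 1/m)^(m+1) >= 2], without denominators. *)
Lemma double_pow_pred m : 2 * m ^ m.+1 <= m.+1 ^ m.+1.
Proof.
case: m => // m; rewrite -(leq_pmul2l (ltn0Sn m)).
apply: leq_trans (bernoulli m.+1 m.+2); rewrite mulnCA mulnA mulnC.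
by rewrite leq_mul2l; apply/orP; right; lia.
Qed.

Lemma pow3_growth j : 32 <= j -> 25 * j ^ 6 <= 3 ^ j.
Proof.
move=> hj; pose i := j %/ 8.
have i4 : 4 <= i by rewrite leq_divRL.
have ji : j <= 2 ^ (i + 3).
  apply: ltnW; apply: leq_trans (_ : 8 * i.+1 <= _); first by rewrite /i; lia.
  by rewrite expnD mulnC leq_mul2r ltn_expl.
apply: (@leq_trans (2 ^ (5 + (i + 3) * 6))).
  by rewrite expnD (expnM _ _ 6) leq_mul // leq_exp2r.
apply: (@leq_trans (2 ^ (3 * (4 * i)))); first by rewrite leq_pexp2l //; lia.
apply: (@leq_trans (3 ^ (2 * (4 * i)))).
  by rewrite (expnM 2 3) (expnM 3 2) leq_exp2r // muln_gt0; lia.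
by rewrite leq_pexp2l // /i; lia.
Qed.

(* With [r = 3 ^ j] we have [q = 3 * r ^ 4] and [n] of order [r ^ 9], so that
   [q ^ 2] is much smaller than [n], and [n] much smaller than [q ^ 3]. *)
Section NumericBounds.
Variables (c j n mu : nat).
(** The odd exponent makes [q] congruent to 3 modulo 4. [h] exceeds the binary logarithm of [q^8],
    and [t] steps of factor [1 - 1 / (4 q^2)] shrink a set by [2^h]. [d] exceeds the logarithm of
    [n], of order [j], by a factor of order [j]. Finally [704 = 4 * 176] fits [exists_split]. *)
Let K := 4 * j + 1.
Let q := 3 ^ K.
Let h := 16 * K.
Let t := 4 * q ^ 2 * h.
Let s := mu %/ 4.
Let d := j ^ 2.
Let k' := (mu * j ^ 2) %/ 704.
Hypotheses (c0 : 0 < c) (hj : 704 * (2 * c + 121) <= j).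
Hypotheses (hn1 : 3 ^ (9 * j + 2) <= n) (hn2 : n < 3 ^ (9 * j + 11)).
Hypothesis (hmu : n <= 2 * c * mu).
Let Y := 3 ^ (8 * j).

Let j32 : 32 <= j. Proof. move: c0 hj; lia. Qed.
Let q2E : q ^ 2 = 9 * Y.
Proof.
rewrite /q /Y -expnM (_ : K * 2 = 2 + 8 * j) ?expnD //; rewrite /K; lia.
Qed.

(** [n] is at least [9 Y 3^j], and [3^j] absorbs the polynomial factor in [j] and the constant
    [c]. *)
Lemma mu_large : 5184 * (K ^ 2 * j ^ 2 * Y) <= mu.
Proof.
have a1 : 1152 * c * (K ^ 2 * j ^ 2) <= 3 ^ j.
  apply: leq_trans (pow3_growth j32).
  have b1 : K ^ 2 <= 25 * j ^ 2.
    by rewrite (_ : 25 = 5 ^ 2) // -expnMn leq_exp2r // /K; lia.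
  have b2 : 1152 * c <= j ^ 2 by move: c0 hj j32; rewrite expnS expn1; nia.
  apply: (@leq_trans (j ^ 2 * (25 * j ^ 2 * j ^ 2))).
    by rewrite leq_mul // leq_mul2r b1 orbT.
  by apply: eq_leq; ring.
have a2 : 9 * Y * 3 ^ j <= 2 * c * mu.
  apply: leq_trans hmu; apply: leq_trans hn1; apply: eq_leq.
  by rewrite /Y (_ : 9 = 3 ^ 2) // -!expnD; congr (_ ^ _); lia.
have c2 : 0 < 2 * c by rewrite muln_gt0.
rewrite -(leq_pmul2l c2); apply: leq_trans a2.
apply: leq_trans (leq_mul (leqnn (9 * Y)) a1); apply: eq_leq.
by move: (K ^ 2) (j ^ 2) Y => u v w; ring.
Qed.

Let q_gt1 : 1 < q.
Proof. by rewrite -(expn0 3) ltn_exp2l // /K addn1. Qed.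

Lemma log_bound : q ^ 8 < 2 ^ h.
Proof.
have -> : h = 2 * (K * 8) by rewrite /h; lia.
rewrite /q -expnM (expnM 2 2) ltn_exp2r // muln_gt0 /K addn1 //.
Qed.

Lemma container_depth : q ^ 8 * (4 * q ^ 2 - 1) ^ t <= 32 * q ^ 5 * (4 * q ^ 2) ^ t.
Proof.
have q0 : 0 < q := ltnW q_gt1.
apply: (@leq_trans (2 ^ h * (4 * q ^ 2 - 1) ^ t)).
  by rewrite leq_mul2r (ltnW log_bound) orbT.
apply: (@leq_trans ((4 * q ^ 2) ^ t)); last first.
  by rewrite leq_pmull // muln_gt0 expn_gt0 q0.
rewrite /t; have : 0 < 4 * q ^ 2 by rewrite muln_gt0 expn_gt0 q0.
case: (4 * q ^ 2) => // m _; rewrite subn1 /= !(expnM _ m.+1) -expnMn.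
have : 0 < h by rewrite /h muln_gt0 /K addn1.
by move: h => h' h0; rewrite leq_exp2r // double_pow_pred.
Qed.

Let mu_ge8 : 8 <= mu.
Proof.
apply: leq_trans mu_large; rewrite (@leq_trans (5184 * 1)) // leq_mul2l.
by rewrite !muln_gt0 !expn_gt0 /K addn1 (leq_trans _ j32).
Qed.

Lemma container_cost : 4 * (t * d) <= mu.
Proof.
apply: leq_trans mu_large; rewrite /t /d /h q2E.
apply: (@leq_trans (2304 * (K * j ^ 2 * Y))); first by apply: eq_leq; ring.
by rewrite leq_mul // !leq_mul2r expnS expn1 leq_pmulr ?orbT // /K addn1.
Qed.

(** The exponent of 3 is [9 * K * t = 5184 * K^2 * Y]. *)
Lemma container_number : (q ^ 8).+1 ^ t <= 3 ^ mu.
Proof.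
apply: (@leq_trans ((q ^ 9) ^ t)).
  have t0 : 0 < t by rewrite /t /h !muln_gt0 ?expn_gt0 /K addn1.
  by rewrite leq_exp2r // ltn_exp2l.
rewrite -expnM /q -expnM leq_pexp2l //; apply: leq_trans mu_large.
rewrite /t /h q2E; apply: (@leq_trans (5184 * (K ^ 2 * 1 * Y))).
  by apply: eq_leq; ring.
by rewrite leq_mul2l leq_mul2r leq_mul2l expn_gt0 (leq_trans _ j32) ?orbT.
Qed.

Let n_pow e : n ^ e <= 3 ^ ((9 * j + 11) * e).
Proof. by rewrite expnM; case: e => // e; rewrite leq_exp2r // ltnW. Qed.

Let two_pow : 2 ^ n <= 3 ^ n.
Proof. by case: (n) => // n'; rewrite leq_exp2r. Qed.

Lemma few_lines_bound : 3 * n ^ 12 < q ^ 28.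
Proof.
apply: (@leq_ltn_trans (3 ^ (1 + (9 * j + 11) * 12))).
  by rewrite expnD expn1 leq_mul2l n_pow orbT.
by rewrite /q -expnM ltn_exp2l // /K; move: j32; lia.
Qed.

(** The gain [(K - j) s = (3 j + 1) s] outweighs [n] and [mu], which are at most [16 c s] and
    [8 s]. *)
Lemma side_exponent : 2 + n + mu + j * s < K * s.
Proof.
have s8 : mu <= 8 * s by rewrite /s; move: mu_ge8; lia.
have h1 : n <= 2 * c * (8 * s) by apply: leq_trans hmu _; rewrite leq_mul2l s8 orbT.
have s0 : 0 < s by move: mu_ge8 s8; lia.
have h2 : (16 * c + 11) * s <= (3 * j) * s by rewrite leq_mul2r; move: hj; lia.
move: h1 h2 s8 s0; rewrite /K; move: s => x; nia.
Qed.

Lemma few_sides_bound : 6 * 2 ^ n * (q ^ 8).+1 ^ t * (64 * h) ^ s < q ^ s.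
Proof.
have hs : (64 * h) ^ s <= 3 ^ (j * s).
  have : 64 * h <= 3 ^ j.
    apply: leq_trans (pow3_growth j32).
    have j704 : 704 <= j by apply: leq_trans hj; rewrite leq_pmulr // addn_gt0 orbT.
    have hK : 16 * (4 * K) <= 16 * (20 * j) by rewrite leq_mul2l /K; move: j32; lia.
    apply: (@leq_trans (16 * (16 * (20 * j)))).
      by rewrite /h (_ : 64 = 16 * 4) // -mulnA leq_mul2l (mulnCA 4) hK orbT.
    apply: (@leq_trans (25 * (704 * j))).
      by rewrite !mulnA leq_mul2r; apply/orP; right.
    apply: (@leq_trans (25 * j ^ 2)).
      by rewrite leq_mul2l expnS expn1 leq_mul2r j704 !orbT.
    by rewrite leq_mul2l leq_pexp2l // (leq_trans _ j32).
  by rewrite expnM; case: (s) => // s' ?; rewrite leq_exp2r.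
apply: (@leq_ltn_trans (3 ^ (2 + n + mu + j * s))).
  by rewrite !expnD !leq_mul // container_number.
by rewrite /q -expnM ltn_exp2l // side_exponent.
Qed.

(** The leading terms are [45 j mu] and [60 j mu]; the difference absorbs [n], at most [2 c mu]. *)
Lemma captured_exponent : 1 + n + mu + (9 * j + 11) * (5 * mu) + 4 * (5 * mu) < K * (15 * mu).
Proof.
have h2 : (2 * c + 62) * mu <= (15 * j) * mu by rewrite leq_mul2r; move: hj; lia.
by move: hmu h2 mu_ge8; rewrite /K; nia.
Qed.

Lemma captured_bound :
  3 * 2 ^ n * (q ^ 8).+1 ^ t * n ^ (5 * mu) * 32 ^ (5 * mu) < q ^ (15 * mu).
Proof.
apply: (@leq_ltn_trans (3 ^ (1 + n + mu + (9 * j + 11) * (5 * mu) + 4 * (5 * mu)))).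
  rewrite (expnD 3 _ (4 * (5 * mu))) leq_mul //; last first.
    by rewrite (expnM 3 4); case: (5 * mu) => // e; rewrite leq_exp2r.
  rewrite (expnD 3 _ ((9 * j + 11) * (5 * mu))) leq_mul //.
  rewrite (expnD 3 _ mu) leq_mul ?container_number //.
  by rewrite expnD expn1 leq_mul.
by rewrite /q -expnM ltn_exp2l // captured_exponent.
Qed.

(** The left side is at most [mu] times a linear function of [j], whereas [k'] is of order
    [mu * j^2]. *)
Lemma split_exponent : n + (9 * j + 11) * (6 * mu) < k'.
Proof.
have h1 : 704 * (2 * c + 67 + 54 * j) <= j ^ 2.
  apply: (@leq_trans (704 * (2 * c + 121) * j)).
    by rewrite -mulnA leq_mul2l; apply/orP; right; move: j32 c0; nia.
  by rewrite expnS expn1 leq_mul2r hj orbT.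
have h2 : (2 * c + 67 + 54 * j) * mu <= k'.
  by rewrite /k' leq_divRL // mulnC mulnA [mu * _]mulnC leq_mul2r h1 orbT.
apply: leq_trans h2; move: hmu mu_ge8; nia.
Qed.

(** As [3^5 <= 4^4], the factor [(4/3)^(4 k')] is at least [3^k']. *)
Lemma split_bound : 2 ^ n * n ^ (6 * mu) * 3 ^ (4 * k') < 4 ^ (4 * k').
Proof.
apply: (@leq_trans (3 ^ k' * 3 ^ (4 * k'))).
  rewrite ltn_pmul2r ?expn_gt0 //.
  apply: leq_ltn_trans (_ : 3 ^ (n + (9 * j + 11) * (6 * mu)) < _).
    by rewrite expnD leq_mul.
  by rewrite ltn_exp2l // split_exponent.
rewrite -expnD (_ : k' + 4 * k' = 5 * k'); last by lia.
by rewrite !expnM; case: (k') => // e; rewrite leq_exp2r.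
Qed.

End NumericBounds.

(** * The field, the graph and the final estimate *)

Local Open Scope ring_scope.

(** Here [q = 3 + 4 e]. If [x^2 = -1], then [x^4 = 1], so [x = x^q = x^3 = -x], which forces [x = 0]
    in characteristic 3. *)
Lemma exists_field_sqN1 j : exists F : finFieldType,
  #|F| = (3 ^ (4 * j + 1))%N /\ forall x : F, x ^+ 2 != -1.
Proof.
have k0 : (0 < 4 * j + 1)%N by rewrite addn1.
have [F charF cF] := PrimePowerField (isT : prime 3) k0.
exists F; split=> // x; apply/negP => /eqP x2.
have [e qE] : exists e, (3 ^ (4 * j + 1) = 3 + 4 * e)%N.
  elim: j {k0 cF} => [|j [e IH]]; first by exists 0%N.
  exists (81 * e + 60)%N.
  rewrite (_ : 4 * j.+1 + 1 = 4 + (4 * j + 1))%N; last by lia.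
  by rewrite (expnD 3 4) IH; lia.
have x4 : x ^+ 4 = 1 by rewrite (exprM x 2 2) x2 sqrrN expr1n.
have xq : - x = x.
  rewrite -[RHS]expf_card cF qE exprD exprM x4 expr1n mulr1.
  by rewrite exprS x2 mulrN1.
have three : (3%:R : F) = 0 by apply/eqP; case/andP: charF.
have x0 : x = 0.
  have -> : x = 3%:R * x - (x + x) by ring.
  by rewrite three mul0r -{1}xq addNr subrr.
by move/eqP: x2; rewrite x0 expr0n eq_sym oppr_eq0 oner_eq0.
Qed.

Lemma div9_bounds l : (2 <= l)%N ->
  (9 * ((l - 2) %/ 9) + 2 <= l)%N /\ (l < 9 * ((l - 2) %/ 9) + 11)%N.
Proof. by move=> h; split; lia. Qed.

Lemma exists_dense_graph c : (0 < c)%N -> exists N, forall n, (N <= n)%N ->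
  exists H : rel 'I_n, [/\ symmetric H, irreflexive H,
    forall u v w, H u v -> H v w -> H u w -> False &
    forall (B : {set 'I_n}) (phi : 'I_n -> 'I_n), #|B| = (6 * (n %/ c))%N ->
      {in B &, injective phi} -> (forall i, i \in B -> phi i \notin B) ->
      exists i j, [/\ i \in B, j \in B, H i j & H (phi i) (phi j)]].
Proof.
move=> c0; pose j0 := (704 * (2 * c + 121))%N.
exists (3 ^ (9 * j0 + 2) + c)%N => n hn.
have n0 : (0 < n)%N by apply: leq_trans hn; rewrite addn_gt0 expn_gt0.
have hl : (9 * j0 + 2 <= trunc_log 3 n)%N.
  by apply: trunc_log_max => //; apply: leq_trans hn; apply: leq_addr.
(* With this [j] the base-3 logarithm of [n] lies in the window from [9 j + 2] to [9 j + 11]. *)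
pose j := ((trunc_log 3 n - 2) %/ 9)%N; pose mu := (n %/ c)%N.
have hj : (j0 <= j)%N by rewrite leq_divRL // leq_subRL; move: hl; lia.
have [l1 l2] := div9_bounds (leq_trans (leq_addl _ _) hl).
have hn1 : (3 ^ (9 * j + 2) <= n)%N.
  apply: leq_trans (trunc_logP (isT : 1 < 3)%N n0); by rewrite leq_pexp2l.
have hn2 : (n < 3 ^ (9 * j + 11))%N.
  apply: leq_trans (trunc_log_ltn n (isT : 1 < 3)%N) _; by rewrite leq_pexp2l.
have hmu : (n <= 2 * c * mu)%N.
  have mu0 : (0 < mu)%N by rewrite divn_gt0 //; apply: leq_trans hn; apply: leq_addl.
  apply: (@leq_trans (c * mu.+1)); first by rewrite mulnC ltnW // ltn_ceil.
  by rewrite -mulnA mulnCA leq_mul2l; apply/orP; right; move: mu0; lia.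
have [F [cF sqN1]] := exists_field_sqN1 j.
have q1 : (1 < #|F|)%N by apply: finNzRing_gt1.
have v0 : 'I_n := Ordinal n0.
have codegG (x y : point F) : #|[set z | lightlike x z && lightlike z y]| =
    (if x == y then #|F| ^ 3 - #|F| ^ 2 + #|F| else if lightlike x y then #|F| else #|F| ^ 2 - #|F|)%N.
  by rewrite (card_common sqN1) /codegree_value subr_eq0.
have third := line_third sqN1.
have Gs := @lightlike_sym F; have Gr := @lightlike_refl F.
have [||||||||f [few many]] := @exists_good_sample _ #|F| (@lightlike F) q1 Gs Gr
  (card_point F) codegG 'I_n v0 (4 * #|F| ^ 2 * (16 * (4 * j + 1))) (16 * (4 * j + 1))
  (mu %/ 4) mu (j ^ 2).
- by rewrite cF; exact: container_depth c0 hj hn1 hn2 hmu.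
- by rewrite cF; exact: log_bound c0 hj hn1 hn2 hmu.
- by rewrite card_ord cF; exact: few_lines_bound c0 hj hn1 hn2 hmu.
- by rewrite card_ord cF; exact: few_sides_bound c0 hj hn1 hn2 hmu.
- by rewrite card_ord cF; exact: captured_bound c0 hj hn1 hn2 hmu.
- by rewrite cF; exact: container_cost c0 hj hn1 hn2 hmu.
- by rewrite mulnC leq_trunc_div.
- by rewrite expn_gt0 (leq_trans _ hj) // /j0 muln_gt0 addn_gt0 orbT.
have [||c' split] := @exists_split _ _ Gr 'I_n f v0 mu (j ^ 2) (4 * ((mu * j ^ 2) %/ 704))
  few many.
- by rewrite mulnA mulnC leq_trunc_div.
- by rewrite card_ord; exact: split_bound c0 hj hn1 hn2 hmu.
exists (split_graph (@lightlike F) f c'); split=> //.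
- exact: split_graph_sym.
- exact: split_graph_irrefl.
- by move=> u v w; apply: (split_graph_triangle_free Gs third).
Qed.

Theorem theorem1p4 (R : realType) (eta : R) :
  0 < eta ->
  exists N : nat, forall n : nat, (N <= n)%N ->
    exists e : rel 'I_n,
      [/\ simple_graph e,
          (alpha e <= 2)%N
        & forall t : nat, (3^-1 + eta) * n%:R <= t%:R -> ~ has_odd_minor e t].
Proof.
(* With [mu = n %/ c] the error [54 * mu] is at most [3 * eta * n], so [3 * t >= n + 3 * eta * n]
   contradicts [odd_minor_order]. *)
move=> eta0; pose c := Num.bound (18%:R / eta).
have hc : 18%:R <= eta * c%:R.
  by rewrite mulrC -ler_pdivrMr // ltW // archi_boundP // divr_ge0 // ltW.
have c0 : (0 < c)%N.
  by rewrite lt0n; apply/eqP => c0; move: hc; rewrite c0 mulr0 lern0.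
have [N hN] := exists_dense_graph c0.
exists N => n /hN [H [Hs Hi Ht Hp]]; exists (complement H); split.
- exact: complement_simple.
- exact: complement_alpha.
move=> t ht [S [F [chi [tS dS pF mt]]]].
have := odd_minor_order Hi Hp tS dS pF mt; rewrite card_ord ltnNge => /negP; apply.
rewrite -(ler_nat R) natrD !natrM.
have h1 : c%:R * (n %/ c)%:R <= n%:R :> R by rewrite -natrM ler_nat mulnC leq_trunc_div.
have h2 : eta * (c%:R * (n %/ c)%:R) <= eta * n%:R by rewrite ler_wpM2l // ltW.
have h3 : 18%:R * (n %/ c)%:R <= eta * c%:R * (n %/ c)%:R by rewrite ler_wpM2r.
move: ht h2 h3; rewrite mulrDl mulrA; lra.
Qed.
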